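(* Let $a,b,c,x,q\in\mathbb{C}^{\times}$, let $p\in\mathbb{C}$ with $0<|p|<1$, and let $n,m\in\mathbb{N}_0$. Then, as an identity of totally elliptic functions of $\log_q x,\log_q a,\log_q b,\log_q c$ (i.e. as an identity of meromorphic functions in these variables), \begin{align*} 1 &=\frac{(ac, c/a, bx, b/x; q, p)_{n+1}}{(ab, b/a, cx, c/x; q, p)_{n+1}} \sum_{k=0}^{m} \frac{\theta(acq^{n+2k}; p) (acq^n, bcq^n, c/b, q^{n+1}, a x, a/x; q, p)_k} {\theta(acq^n; p) (q, aq/b, abq^{1+n}, ac, cq^{n+1}/x, cxq^{n+1}; q, p)_k} q^k\\ &\quad+ \frac{(bc, c/b, ax, a/x; q, p)_{m+1}} {(ab, a/b, cx, c/x; q, p)_{m+1}} \sum_{k=0}^n \frac{\theta(bcq^{m+2k}; p) (bcq^m, acq^m, c/a, q^{m+1}, b x, b/x; q, p)_k} {\theta(bcq^m; p) (q, bq/a, ab q^{1+m}, bc, cq^{m+1}/x, cxq^{m+1}; q, p)_k} q^k. \end{align*}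
   Context: For $x\in\mathbb{C}$ and $|p|<1$, $(x;p)_\infty:=\prod_{\ell\ge0}(1-xp^\ell)$. The modified Jacobi theta function is $\theta(x;p):=(x;p)_\infty(p/x;p)_\infty$ for $x\in\mathbb{C}^\times$, and $\theta(x_1,\dots,x_s;p):=\prod_{i=1}^s\theta(x_i;p)$. The theta-shifted factorial is $(x;q,p)_0:=1$, $(x;q,p)_k:=\prod_{\ell=0}^{k-1}\theta(xq^\ell;p)$ for $k\ge1$, and $(x_1,\dots,x_s;q,p)_k:=\prod_{i=1}^s(x_i;q,p)_k$. Writing $q=e^{2\pi\sqrt{-1}\sigma}$, $p=e^{2\pi\sqrt{-1}\tau}$ with $\Im\tau>0$, a totally elliptic function of $u_1,\dots,u_s$ is a function meromorphic in each $u_i$ and doubly periodic in each $u_i$ with periods $\sigma^{-1}$ and $\tau\sigma^{-1}$. *)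

(* Defs.v *)
From HB Require Import structures.
From mathcomp Require Export all_boot all_order all_algebra.
From mathcomp Require Export complex.
From mathcomp Require Export all_classical all_reals all_analysis.

Set Implicit Arguments.
Unset Strict Implicit.
Unset Printing Implicit Defensive.

Export Order.TTheory GRing.Theory Num.Theory.
Export numFieldNormedType.Exports.

Global Open Scope classical_set_scope.
Global Open Scope ring_scope.
Global Open Scope complex_scope.

Section Theta.
Variable R : realType.
Local Notation C := R[i].
Implicit Types (a b c x q p : C) (xs : seq C) (n m k : nat).

Definition qpoch_inf x p : C :=
  limn (fun N : nat => \prod_(l < N) (1 - x * p ^+ l) : C^o).

Definition theta x p : C := qpoch_inf x p * qpoch_inf (p / x) p.

Definition theta_fact1 x q p k : C := \prod_(l < k) theta (x * q ^+ l) p.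

Definition theta_fact xs q p k : C := \prod_(x <- xs) theta_fact1 x q p k.

(* The two summands of the identity are exchanged by the simultaneous swap    *)
(* a <-> b, n <-> m, so each ingredient is written once, for the first one.   *)

Definition prefactor_num q p n a b c x : C :=
  theta_fact [:: a * c; c / a; b * x; b / x] q p n.+1.

Definition prefactor_den q p n a b c x : C :=
  theta_fact [:: a * b; b / a; c * x; c / x] q p n.+1.

Definition term_num q p n a b c x k : C :=
  theta (a * c * q ^+ (n + 2 * k)) p *
  theta_fact [:: a * c * q ^+ n; b * c * q ^+ n; c / b; q ^+ n.+1;
                 a * x; a / x] q p k.

Definition term_den q p n a b c x k : C :=
  theta (a * c * q ^+ n) p *
  theta_fact [:: q; a * q / b; a * b * q ^+ (1 + n); a * c;
                 c * q ^+ n.+1 / x; c * x * q ^+ n.+1] q p k.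

Definition summand q p n m a b c x : C :=
  prefactor_num q p n a b c x / prefactor_den q p n a b c x *
  \sum_(0 <= k < m.+1)
    term_num q p n a b c x k / term_den q p n a b c x k * q ^+ k.

(* No denominator displayed in summand q p n m a b c x vanishes. *)
Definition regular_point q p n m a b c x : Prop :=
  prefactor_den q p n a b c x != 0 /\
  (forall k, (k <= m)%N -> term_den q p n a b c x k != 0).

End Theta.

Section Elliptic.
Variable R : realType.
Local Notation C := R[i].
Implicit Types (z w sigma tau : C).

Definition cexp z : C :=
  (expR (complex.Re z) * cos (complex.Im z)) +i*
  (expR (complex.Re z) * sin (complex.Im z)).

(* exp (2 pi sqrt(-1) z) *)
Definition cexp2pi z : C := cexp ((0 +i* (2 * pi)) * z).

Definition holomorphic_near (f : C^o -> C^o) (z : C^o) : Prop :=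
  \forall w \near z, derivable f w 1.

(* A meromorphic function on C is represented by a total function, whose      *)
(* values on a discrete set (in particular at the poles) are irrelevant.      *)
Definition meromorphic (f : C -> C) : Prop :=
  forall z : C^o, exists (N : nat) (g : C^o -> C^o),
    holomorphic_near g z /\
    \forall w \near z^', (w - z) ^+ N * f w = g w.

Definition totally_elliptic sigma tau s (f : ('I_s -> C) -> C) : Prop :=
  forall (i : 'I_s) (u : 'I_s -> C),
    let fi : C -> C := fun w => f [eta u with i |-> w] in
    [/\ meromorphic fi,
        forall w, fi (w + sigma^-1) = fi w
      & forall w, fi (w + tau / sigma) = fi w].

End Elliptic.

(* Main.v *)
Require Import Defs.
From mathcomp Require Import zify ring lra.
Import Normc.

(** The first sum is a sum of weights T(n,k), 0 <= k <= m, and the second one a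
    sum of weights T'(k,m), 0 <= k <= n: they are the probabilities that a
    random lattice path from (0,0) leaves the rectangle [0,n] x [0,m] through
    its right side at height k, respectively through its upper side at abscissa
    k.  Both T(n,k) + T'(n,k) (leaving the point (n,k)) and T(n-1,k) + T'(n,k-1)
    (arriving at it) equal the same product, by two instances of the Weierstrass
    three-term relation, so the total is constant in n and m.  Writing the
    weights with the common factors (q, ac, bc)_{n+k} in the numerator makes
    this work at every regular point, without genericity or density arguments.

    The three-term relation is a Pluecker relation: by the Jacobi triple
    product, theta(xy) theta(x/y) is, up to a constant, the 2 x 2 determinant
    x (B1(x) B0(y) - B0(x) B1(y)), where B0 and B1 collect the terms
    p^(d^2) y^(2d) and p^(d^2+d) y^(2d+1).  All limits are controlled by
    explicit errors O(|p|^N).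

    Ellipticity follows from theta(px) = -theta(x)/x.  For meromorphy, theta
    composed with an exponential is holomorphic with simple zeros, and 1/f has
    at a simple zero z the property that (w-z)^2 / f(w) is differentiable. *)

Set Implicit Arguments.
Unset Strict Implicit.
Unset Printing Implicit Defensive.

(** * Modulus and geometric limits *)

Section ComplexNorm.
Variable R : realType.
Local Notation C := R[i].
Implicit Types (z w : C) (r : R).

(** The obstacle is division by zero. Regularity keeps (q)_n and (q)_m nonzero but not (q)_(n+k),
    (ac)_(n+k) or (bc)_(n+k), which can vanish at regular points, for instance when q is a suitable
    root of unity. Quotients of consecutive weights cannot be formed, so these factorials may occur
    in numerators only.

    Elsewhere the convention x / 0 = 0 helps: periodicity holds at every argument, poles included,
    because numerator and denominator acquire the same nonzero factor, and 1 / theta stays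
    meromorphic when theta vanishes identically along a coordinate.

    The determinant relation is exact for the truncated sums at each N; only the comparison of theta
    with its truncations is analytic. That comparison opposes a square box of Z^2 to a rotated one,
    hence the absolute bounds by rho^(2|i|) rho^(2|j|). The symmetric variables of the relation are
    square roots of products of theta arguments; one square root of z leads to the product form
    needed for the telescoping.

    Estimates are made with the real-valued [normc], since the norm of R[i] takes its values in
    R[i]. *)

Lemma normc_ge0 z : 0 <= normc z.
Proof. by case: z => a b /=; rewrite sqrtr_ge0. Qed.

Lemma normr_normc z : `|z| = (normc z)%:C.
Proof. by case: z. Qed.

Lemma normc_eq0 z : (normc z == 0) = (z == 0).
Proof.
by apply/eqP/eqP => [/eq0_normc //|->]; rewrite normc0.
Qed.

Lemma normc_gt0 z : (0 < normc z) = (z != 0).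
Proof. by rewrite lt_def normc_ge0 andbT normc_eq0. Qed.

Lemma normcD z w : normc (z + w) <= normc z + normc w.
Proof. exact: le_normcD. Qed.

Lemma normcNE z : normc (- z) = normc z.
Proof. exact: normcN. Qed.

Lemma normcB z w : normc (z - w) <= normc z + normc w.
Proof. by rewrite -(normcNE w); exact: normcD. Qed.

Lemma normc_dist z w v : normc (z - w) <= normc (z - v) + normc (v - w).
Proof. by rewrite -[z - w](subrKA v); exact: normcD. Qed.

Lemma normc_distC z w : normc (z - w) = normc (w - z).
Proof. by rewrite -normcNE opprB. Qed.

Lemma normc_ler_sub z w : normc z - normc w <= normc (z - w).
Proof. by rewrite lerBlDr -{1}[z](subrK w); exact: normcD. Qed.

Lemma normcX z n : normc (z ^+ n) = normc z ^+ n.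
Proof.
by elim: n => [|n IH]; rewrite ?expr0 ?normc1 // !exprS normcM IH.
Qed.

Lemma normc_prod I (s : seq I) (P : pred I) (F : I -> C) :
  normc (\prod_(i <- s | P i) F i) = \prod_(i <- s | P i) normc (F i).
Proof.
by elim/big_rec2: _ => [|i y1 y2 _ <-]; rewrite ?normc1 ?normcM.
Qed.

Lemma normc_sum I (s : seq I) (P : pred I) (F : I -> C) :
  normc (\sum_(i <- s | P i) F i) <= \sum_(i <- s | P i) normc (F i).
Proof.
elim/big_rec2: _ => [|i y1 y2 _ h]; first by rewrite normc0.
by apply: le_trans (normcD _ _) _; rewrite lerD2l.
Qed.

Lemma normc_real r : normc (r%:C : C) = `|r|.
Proof. by rewrite /= expr0n addr0 sqrtr_sqr. Qed.

Lemma normr_Re_le z : `|complex.Re z| <= normc z.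
Proof.
by case: z => a b /=; rewrite -sqrtr_sqr ler_wsqrtr // lerDl sqr_ge0.
Qed.

Lemma normr_Im_le z : `|complex.Im z| <= normc z.
Proof.
by case: z => a b /=; rewrite -sqrtr_sqr ler_wsqrtr // lerDr sqr_ge0.
Qed.

Lemma normc_le_ReIm z : normc z <= `|complex.Re z| + `|complex.Im z|.
Proof.
case: z => a b /=.
have -> : `|a| + `|b| = Num.sqrt ((`|a| + `|b|) ^+ 2).
  by rewrite sqrtr_sqr [RHS]ger0_norm ?addr_ge0.
apply: ler_wsqrtr; rewrite sqrrD !real_normK ?num_real //.
have := mulr_ge0 (normr_ge0 a) (normr_ge0 b); lra.
Qed.

Lemma lt0_real_complex (e : C) : 0 < e -> exists2 d : R, 0 < d & e = d%:C.
Proof.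
case: e => a b; rewrite ltcE /= => /andP[/eqP -> a0].
by exists a.
Qed.

End ComplexNorm.

(** * Sequences with geometrically small increments *)

Section GeometricBounds.
Variable R : realType.
Local Notation C := R[i].
Implicit Types (r K : R).

Lemma geometric_small r K e : 0 <= r < 1 -> 0 < e ->
  exists N : nat, forall n, (N <= n)%N -> K * r ^+ n <= e.
Proof.
move=> /andP[r0 r1] e0.
have h : `|r| < 1 by rewrite ger0_norm.
have /cvgr0Pnorm_le/(_ e e0) [N _ hN] := @cvg_geometric _ K _ h.
exists N => n Nn; have := hN n Nn => /=; exact: le_trans (ler_norm _).
Qed.

Lemma le0_geometric r K a : 0 <= r < 1 -> (forall n, a <= K * r ^+ n) -> a <= 0.
Proof.
move=> r01 h; apply/ler_addgt0Pr => e e0; rewrite add0r.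
have [N /(_ N (leqnn N))] := geometric_small K r01 e0.
exact: le_trans (h N).
Qed.

Lemma normc_geometric_eq r K (z w : C) : 0 <= r < 1 ->
  (forall n, normc (z - w) <= K * r ^+ n) -> z = w.
Proof.
move=> r01 /(le0_geometric r01) h; apply/eqP; rewrite -subr_eq0 -normc_eq0.
by rewrite eq_le h normc_ge0.
Qed.

Lemma geometric_sum_le r n : 0 <= r < 1 ->
  \sum_(l < n) r ^+ l <= (1 - r)^-1.
Proof.
move=> /andP[r0 r1].
have h : (1 - r) * \sum_(l < n) r ^+ l = 1 - r ^+ n.
  by rewrite -opprB mulNr -subrX1 opprB.
rewrite -[X in _ <= X]mul1r ler_pdivlMr ?subr_gt0 // mulrC h.
by rewrite gerBl exprn_ge0.
Qed.

(** With e n = K r^n / (1 - r) the intervals [v n - e n, v n + e n] are nested, because e n - e (n +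
    1) = K r^n. The limit is the supremum of their left ends. *)
Lemma real_geometric_limit (v : nat -> R) r K : 0 <= r < 1 ->
  (forall n, `|v n.+1 - v n| <= K * r ^+ n) ->
  exists l, forall n, `|v n - l| <= K / (1 - r) * r ^+ n.
Proof.
move=> r01 hv; have /andP[r0 r1] := r01.
pose e n := K / (1 - r) * r ^+ n.
have eS n : e n - e n.+1 = K * r ^+ n.
  by rewrite /e exprS; field; lra.
have K0 : 0 <= K by have := le_trans (normr_ge0 _) (hv 0%N); rewrite mulr1.
have e0 n : 0 <= e n.
  by rewrite /e mulr_ge0 ?exprn_ge0 // divr_ge0 // subr_ge0 ltW.
have lo n k : v n - e n <= v (n + k)%N - e (n + k)%N.
  elim: k => [|k IH]; first by rewrite addn0.
  apply: le_trans IH _; rewrite addnS.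
  have := hv (n + k)%N; rewrite -eS ler_norml => /andP[]; lra.
have hi n k : v (n + k)%N + e (n + k)%N <= v n + e n.
  elim: k => [|k IH]; first by rewrite addn0.
  apply: le_trans IH; rewrite addnS.
  have := hv (n + k)%N; rewrite -eS ler_norml => /andP[]; lra.
have lohi n m : v n - e n <= v m + e m.
  have h := lo n m; have h' := hi m n; have := e0 (n + m)%N.
  move: h'; rewrite addnC; lra.
pose S := [set v n - e n | n in setT].
have S0 : S !=set0 by exists (v 0%N - e 0%N), 0%N.
have ubS m : ubound S (v m + e m) by move=> _ [n _ <-].
have hS : has_sup S by split => //; exists (v 0%N + e 0%N).
exists (sup S) => n; rewrite ler_norml.
have h1 : v n - e n <= sup S.
  by apply: ub_le_sup; [case: hS | exists n].
have h2 : sup S <= v n + e n by apply: ge_sup.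
rewrite -/(e n); apply/andP; split; lra.
Qed.

(** Coordinatewise; the factor 2 adds the errors of the real and imaginary parts. *)
Lemma geometric_limit (u : nat -> C) r K : 0 <= r < 1 ->
  (forall n, normc (u n.+1 - u n) <= K * r ^+ n) ->
  exists l, forall n, normc (u n - l) <= 2 * K / (1 - r) * r ^+ n.
Proof.
move=> r01 hu.
have [a ha] : exists l, forall n,
    `|complex.Re (u n) - l| <= K / (1 - r) * r ^+ n.
  apply: real_geometric_limit => // n; apply: le_trans (hu n).
  by apply: le_trans (normr_Re_le _); case: (u n) => ? ?; case: (u n.+1).
have [b hb] : exists l, forall n,
    `|complex.Im (u n) - l| <= K / (1 - r) * r ^+ n.
  apply: real_geometric_limit => // n; apply: le_trans (hu n).
  by apply: le_trans (normr_Im_le _); case: (u n) => ? ?; case: (u n.+1).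
exists (a +i* b) => n; apply: le_trans (normc_le_ReIm _) _.
have -> : 2 * K / (1 - r) * r ^+ n =
  K / (1 - r) * r ^+ n + K / (1 - r) * r ^+ n by ring.
by apply: lerD; [have := ha n | have := hb n]; case: (u n).
Qed.

Lemma geometric_cvg (u : nat -> C) (l : C) r K : 0 <= r < 1 ->
  (forall n, normc (u n - l) <= K * r ^+ n) -> limn (u : nat -> C^o) = l.
Proof.
move=> r01 hu; apply: cvg_lim; first exact: norm_hausdorff.
apply/cvgrPdist_le => e /lt0_real_complex[d d0 ->].
have [N hN] := geometric_small K r01 d0.
exists N => // n Nn /=; rewrite normr_normc lecR normc_distC.
exact: le_trans (hu n) (hN n Nn).
Qed.

End GeometricBounds.

(** * The infinite q-Pochhammer symbol *)

Section QPochhammer.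
Variable R : realType.
Local Notation C := R[i].
Variable p : C.
Hypothesis p_lt1 : normc p < 1.
Local Notation rho := (normc p).
Implicit Types (x y z h : C) (s : R).

Definition qpoch x N : C := \prod_(l < N) (1 - x * p ^+ l).

Let rho01 : 0 <= rho < 1. Proof. by rewrite normc_ge0. Qed.
Let rhoX n : 0 <= rho ^+ n. Proof. by rewrite exprn_ge0 ?normc_ge0. Qed.
Let rhoX1 n : rho ^+ n <= 1. Proof. by rewrite exprn_ile1 ?normc_ge0 // ltW. Qed.

Lemma qpochS x N : qpoch x N.+1 = qpoch x N * (1 - x * p ^+ N).
Proof. by rewrite /qpoch big_ord_recr. Qed.

Lemma qpoch_shift x N : qpoch x N.+1 = (1 - x) * qpoch (x * p) N.
Proof.
rewrite /qpoch big_ord_recl /= expr0 mulr1; congr (_ * _).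
by apply: eq_bigr => l _; rewrite /bump /= add1n exprS mulrA.
Qed.

Definition majorant s N : R := \prod_(l < N) (1 + s * rho ^+ l).

Definition majorant_inf s : R := expR (s / (1 - rho)).

Lemma majorantS s N : majorant s N.+1 = majorant s N * (1 + s * rho ^+ N).
Proof. by rewrite /majorant big_ord_recr. Qed.

Lemma majorant_ge1 s N : 0 <= s -> 1 <= majorant s N.
Proof.
move=> s0; elim: N => [|N IH]; first by rewrite /majorant big_ord0.
rewrite majorantS; have := mulr_ge0 s0 (rhoX N); nra.
Qed.

(** From 1 + t <= exp t in each factor and the geometric series in the exponent. *)
Lemma majorant_le s N : 0 <= s -> majorant s N <= majorant_inf s.
Proof.
move=> s0; apply: (@le_trans _ _ (expR (s * \sum_(l < N) rho ^+ l))).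
  rewrite mulr_sumr expR_sum; apply: ler_prod => l _.
  by rewrite expR_ge1Dx andbT addr_ge0 // mulr_ge0.
by rewrite ler_expR ler_wpM2l // geometric_sum_le.
Qed.

Lemma majorant_inf_ge1 s : 0 <= s -> 1 <= majorant_inf s.
Proof. by move=> s0; exact: le_trans (majorant_ge1 0 s0) (majorant_le 0 s0). Qed.

Lemma majorant_inf_homo s t : s <= t -> majorant_inf s <= majorant_inf t.
Proof.
move=> st; rewrite ler_expR ler_wpM2r // invr_ge0 subr_ge0 ltW //.
Qed.

Lemma normc_factor_le s x N : normc x <= s ->
  normc (1 - x * p ^+ N) <= 1 + s * rho ^+ N.
Proof.
move=> xs; apply: le_trans (normcB _ _) _; rewrite normc1 lerD2l normcM normcX.
by rewrite ler_wpM2r.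
Qed.

Lemma qpoch_norm_le s x N : normc x <= s -> normc (qpoch x N) <= majorant s N.
Proof.
move=> xs; rewrite normc_prod; apply: ler_prod => l _.
by rewrite normc_ge0 normc_factor_le.
Qed.

(** For |x| <= s consecutive partial products differ by at most [s * majorant_inf s] times rho^N;
    [geometric_limit] contributes the factor 2 / (1 - rho). *)
Definition qpoch_rate s : R := 2 * (s * majorant_inf s) / (1 - rho).

Lemma qpoch_inf_approx s x N : normc x <= s ->
  normc (qpoch x N - qpoch_inf x p) <= qpoch_rate s * rho ^+ N.
Proof.
move=> xs; have s0 : 0 <= s := le_trans (normc_ge0 x) xs.
have [n|l hl] := @geometric_limit _ (qpoch x) _ (s * majorant_inf s) rho01.
  have -> : qpoch x n.+1 - qpoch x n = - (qpoch x n * (x * p ^+ n)).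
    by rewrite qpochS; ring.
  rewrite normcNE normcM normcM normcX mulrA ler_wpM2r //.
  rewrite mulrC ler_pM ?normc_ge0 //.
  exact: le_trans (qpoch_norm_le _ xs) (majorant_le _ s0).
suff -> : qpoch_inf x p = l by exact: hl.
exact: (geometric_cvg rho01 hl).
Qed.

Lemma qpoch_inf_shift x : qpoch_inf x p = (1 - x) * qpoch_inf (x * p) p.
Proof.
pose s := normc x.
have xs : normc x <= s by [].
have xps : normc (x * p) <= s by rewrite normcM ler_piMr ?normc_ge0 // ltW.
apply: (@normc_geometric_eq _ rho
  (qpoch_rate s * rho + normc (1 - x) * qpoch_rate s)) => // n.
apply: le_trans (normc_dist _ _ (qpoch x n.+1)) _.
rewrite [leRHS]mulrDl; apply: lerD.
  by rewrite normc_distC -mulrA -exprS qpoch_inf_approx.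
rewrite qpoch_shift -mulrBr normcM -mulrA ler_wpM2l ?normc_ge0 //.
exact: qpoch_inf_approx.
Qed.

Lemma qpoch_inf_split x L :
  qpoch_inf x p = qpoch x L * qpoch_inf (x * p ^+ L) p.
Proof.
elim: L => [|L IH]; first by rewrite /qpoch big_ord0 mul1r expr0 mulr1.
by rewrite qpochS IH (qpoch_inf_shift (x * p ^+ L)) exprSr !mulrA.
Qed.

(** A convergent product vanishes only through one of its factors: once L factors are split off, the
    argument x p^L is so small that the remaining product is within 1/2 of 1. *)
Lemma qpoch_inf_eq0 x : qpoch_inf x p = 0 -> exists l : nat, x * p ^+ l = 1.
Proof.
move=> x0.
(* For e <= 1 one has [qpoch_rate e <= E * e], and e <= 1 / (2 E) makes this at most 1/2. The
   approximation is then used at N = 0, where the partial product is 1. *)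
pose E := 2 * majorant_inf 1 / (1 - rho).
have E0 : 0 < E.
  by rewrite divr_gt0 ?subr_gt0 // mulr_gt0 // expR_gt0.
pose e := Num.min 1 (E^-1 / 2).
have e0 : 0 < e by rewrite /e lt_min ltr01 divr_gt0 ?invr_gt0.
have [L hL] := geometric_small (normc x) rho01 e0.
have yle : normc (x * p ^+ L) <= e by rewrite normcM normcX hL.
have y_neq0 : qpoch_inf (x * p ^+ L) p != 0.
  apply: contraTneq isT => y0.
  have := qpoch_inf_approx 0 yle.
  rewrite y0 /qpoch big_ord0 subr0 normc1 mulr1 /qpoch_rate => h.
  have e1 : e <= 1 by rewrite /e ge_min lexx.
  have e2 : E * e <= 1 / 2.
    rewrite mulrC -ler_pdivlMr // /e ge_min; apply/orP; right.
    by rewrite mul1r mulrC.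
  have : 1 <= E * e.
    apply: le_trans h _; rewrite /E [leRHS]mulrAC ler_wpM2r ?invr_ge0 ?subr_ge0 ?(ltW p_lt1) //.
    rewrite -mulrA ler_wpM2l // mulrC ler_wpM2r ?(ltW e0) //.
    exact: majorant_inf_homo.
  lra.
move: x0; rewrite (qpoch_inf_split x L) => /eqP.
rewrite mulf_eq0 (negbTE y_neq0) orbF => /prodf_eq0[l _].
by rewrite subr_eq0 => /eqP h; exists l.
Qed.

(** Derivative of [qpoch x N] in x, generated by the product rule so that its estimates follow the
    recursion of the products. *)
Fixpoint qpoch_deriv x N : C :=
  if N is N'.+1 then
    qpoch_deriv x N' * (1 - x * p ^+ N') - p ^+ N' * qpoch x N'
  else 0.

Lemma qpoch_deriv_norm_le s x N : normc x <= s ->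
  normc (qpoch_deriv x N) <= majorant (s + 2) N.
Proof.
move=> xs; have s0 : 0 <= s := le_trans (normc_ge0 x) xs.
have s2 : 0 <= s + 2 by lra.
elim: N => [|N IH]; first by rewrite [qpoch_deriv _ _]/= normc0 (le_trans _ (majorant_ge1 _ s2)).
rewrite majorantS /=; apply: le_trans (normcB _ _) _; rewrite !normcM normcX.
have f1 := normc_factor_le N xs.
have f2 : normc (qpoch x N) <= majorant (s + 2) N by apply: qpoch_norm_le; lra.
have m1 := majorant_ge1 N s2; have r0 := rhoX N.
apply: (@le_trans _ _ (majorant (s + 2) N * (1 + s * rho ^+ N)
                       + rho ^+ N * majorant (s + 2) N)).
  by apply: lerD; [apply: ler_pM; rewrite ?normc_ge0 | apply: ler_wpM2l].
nra.
Qed.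

(** The remainder satisfies a recursion in N: it is multiplied by 1 - (x + h) p^N, of modulus at
    most 1 + (s + 1) rho^N because |h| <= 1, and it gains h^2 p^N times the derivative. Together
    these give the factor 1 + (s + 2) rho^N, whence the shift by 2. *)
Lemma qpoch_taylor s x h N : normc x <= s -> normc h <= 1 ->
  normc (qpoch (x + h) N - qpoch x N - h * qpoch_deriv x N)
    <= majorant (s + 2) N * normc h ^+ 2.
Proof.
move=> xs h1; have s0 : 0 <= s := le_trans (normc_ge0 x) xs.
have s2 : 0 <= s + 2 by lra.
elim: N => [|N IH].
  by rewrite /qpoch !big_ord0 [qpoch_deriv _ _]/= subrr mulr0 subr0 normc0 mulr_ge0 ?sqr_ge0 //
    (le_trans _ (majorant_ge1 _ s2)).
have xh : normc (x + h) <= s + 1 by apply: le_trans (normcD _ _) _; lra.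
have -> : qpoch (x + h) N.+1 - qpoch x N.+1 - h * qpoch_deriv x N.+1 =
  (qpoch (x + h) N - qpoch x N - h * qpoch_deriv x N) *
    (1 - (x + h) * p ^+ N) - h ^+ 2 * qpoch_deriv x N * p ^+ N.
  by rewrite !qpochS /=; ring.
apply: le_trans (normcB _ _) _; rewrite !normcM !normcX majorantS.
have f1 := normc_factor_le N xh.
have f2 := qpoch_deriv_norm_le N xs.
have m1 := majorant_ge1 N s2; have r0 := rhoX N.
have hh := sqr_ge0 (normc h).
apply: (@le_trans _ _ (majorant (s + 2) N * normc h ^+ 2 *
  (1 + (s + 1) * rho ^+ N) +
  normc h ^+ 2 * majorant (s + 2) N * rho ^+ N)); last first.
  rewrite le_eqVlt; apply/orP; left; apply/eqP; ring.
apply: lerD; first by apply: ler_pM; rewrite ?normc_ge0.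
by rewrite ler_wpM2r // ler_wpM2l.
Qed.

(** The Taylor remainder of the partial products is at most B |h|^2 for every N, and the other
    errors are O(rho^N) at fixed h. So the excess over B |h|^2 is bounded by a null sequence. *)
Lemma qpoch_inf_taylor x : exists d K, forall h, normc h <= 1 ->
  normc (qpoch_inf (x + h) p - qpoch_inf x p - h * d) <= K * normc h ^+ 2.
Proof.
pose s := normc x; have s0 : 0 <= s := normc_ge0 x.
have xs : normc x <= s by [].
have s2 : 0 <= s + 2 by lra.
pose B := majorant_inf (s + 2).
have fB y N : normc y <= s + 2 -> normc (qpoch y N) <= B.
  by move=> h; exact: le_trans (qpoch_norm_le _ h) (majorant_le _ s2).
have dB N : normc (qpoch_deriv x N) <= B.
  exact: le_trans (qpoch_deriv_norm_le _ xs) (majorant_le _ s2).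
have [n|d hd] := @geometric_limit _ (qpoch_deriv x) _ (B * s + B) rho01.
  have -> : qpoch_deriv x n.+1 - qpoch_deriv x n =
    - (qpoch_deriv x n * x + qpoch x n) * p ^+ n by rewrite /=; ring.
  rewrite normcM normcX normcNE ler_wpM2r //.
  apply: le_trans (normcD _ _) _; rewrite normcM; apply: lerD.
    by apply: ler_pM; rewrite ?normc_ge0.
  by apply: fB; rewrite -/s; lra.
exists d, B => h h1; rewrite -subr_le0.
apply: (@le0_geometric _ rho (qpoch_rate (s + 1) + qpoch_rate s +
  2 * (B * s + B) / (1 - rho))) => // n.
have xh : normc (x + h) <= s + 1 by apply: le_trans (normcD _ _) _; rewrite lerD2l.
have a1 := qpoch_inf_approx n xh.
have a2 := qpoch_inf_approx n xs.
have a3 := hd n.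
have a4 := qpoch_taylor n xs h1.
have a5 : majorant (s + 2) n * normc h ^+ 2 <= B * normc h ^+ 2.
  by rewrite ler_wpM2r ?sqr_ge0 // majorant_le.
rewrite lerBlDl; rewrite !mulrDl.
have -> : qpoch_inf (x + h) p - qpoch_inf x p - h * d =
  (qpoch (x + h) n - qpoch x n - h * qpoch_deriv x n)
  - (qpoch (x + h) n - qpoch_inf (x + h) p)
  + (qpoch x n - qpoch_inf x p) + h * (qpoch_deriv x n - d) by ring.
apply: le_trans (normcD _ _) _; rewrite normcM.
have a6 : normc h * normc (qpoch_deriv x n - d) <= normc (qpoch_deriv x n - d).
  by rewrite ler_piMl ?normc_ge0.
have := normcD (qpoch (x + h) n - qpoch x n - h * qpoch_deriv x n
  - (qpoch (x + h) n - qpoch_inf (x + h) p)) (qpoch x n - qpoch_inf x p).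
have := normcB (qpoch (x + h) n - qpoch x n - h * qpoch_deriv x n)
  (qpoch (x + h) n - qpoch_inf (x + h) p).
move: a1 a2 a3 a4 a5 a6; lra.
Qed.

End QPochhammer.

(** * Double sums over growing boxes *)

Section GeometricApproximation.
Variable R : realType.
Local Notation C := R[i].
Variable rho : R.
Hypothesis rho01 : 0 <= rho < 1.
Implicit Types (f g : nat -> C) (a b : C).

(** Convergence at the fixed rate rho^N. The constant is existential, so that limits pass through
    differences, products and comparisons without tracking it. *)
Definition geo_approx f a :=
  exists K : R, forall N, normc (f N - a) <= K * rho ^+ N.

Let rhoX n : 0 <= rho ^+ n.
Proof. by rewrite exprn_ge0 //; case/andP: rho01. Qed.
Let rhoX1 n : rho ^+ n <= 1.
Proof. by case/andP: rho01 => ? ?; rewrite exprn_ile1 // ltW. Qed.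

Lemma geo_approx_cst a : geo_approx (fun=> a) a.
Proof. by exists 0 => N; rewrite subrr normc0 mul0r. Qed.

Lemma geo_approx_uniq f a b : geo_approx f a -> geo_approx f b -> a = b.
Proof.
move=> [K hK] [L hL]; apply: (@normc_geometric_eq _ rho (K + L)) => // n.
apply: le_trans (normc_dist _ _ (f n)) _; rewrite mulrDl; apply: lerD => //.
by rewrite normc_distC.
Qed.

Lemma geo_approxB f g a b : geo_approx f a -> geo_approx g b ->
  geo_approx (fun N => f N - g N) (a - b).
Proof.
move=> [K hK] [L hL]; exists (K + L) => n.
have -> : f n - g n - (a - b) = (f n - a) - (g n - b) by ring.
by apply: le_trans (normcB _ _) _; rewrite mulrDl; apply: lerD.
Qed.

Lemma geo_approxM f g a b : geo_approx f a -> geo_approx g b ->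
  geo_approx (fun N => f N * g N) (a * b).
Proof.
move=> [K hK] [L hL]; exists (K * (L + normc b) + normc a * L) => n.
have -> : f n * g n - a * b = (f n - a) * g n + a * (g n - b) by ring.
apply: le_trans (normcD _ _) _; rewrite !normcM mulrDl; apply: lerD.
  rewrite mulrAC; apply: ler_pM; rewrite ?normc_ge0 //.
  rewrite -[g n](subrK b); apply: le_trans (normcD _ _) _; rewrite lerD2r.
  have L0 : 0 <= L by have := le_trans (normc_ge0 _) (hL 0%N); rewrite mulr1.
  by apply: le_trans (hL n) _; rewrite ler_piMr.
by rewrite -mulrA ler_wpM2l ?normc_ge0.
Qed.

Lemma geo_approx_trans f g a : geo_approx f a ->
  (exists K : R, forall N, normc (g N - f N) <= K * rho ^+ N) ->
  geo_approx g a.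
Proof.
move=> [K hK] [L hL]; exists (L + K) => n.
by apply: le_trans (normc_dist _ _ (f n)) _; rewrite mulrDl; apply: lerD.
Qed.

End GeometricApproximation.

(** The integers from -N to N, listed as k - N with 0 <= k <= 2N: the indexing in which the
    q-binomial theorem delivers the triple product. *)
Definition zbox N : seq int := [seq k%:Z - N%:Z | k <- iota 0 (N + N.+1)].

Definition zbox2 N : seq (int * int) :=
  [seq (i, j) | i <- zbox N, j <- zbox N].

Lemma mem_zbox N (j : int) : (j \in zbox N) = (`|j| <= N)%N.
Proof.
apply/mapP/idP => [[k]|h].
  by rewrite mem_iota => /andP[_ hk] ->; lia.
by exists (absz (j + N%:Z)); rewrite ?mem_iota; lia.
Qed.

Lemma zbox_uniq N : uniq (zbox N).
Proof. by rewrite map_inj_uniq ?iota_uniq // => a b; lia. Qed.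

Lemma mem_zbox2 N i j : ((i, j) \in zbox2 N) = (`|i| <= N)%N && (`|j| <= N)%N.
Proof.
apply/allpairsP/idP => [[[a b] /= [ha hb [-> ->]]]|/andP[hi hj]].
  by rewrite -!mem_zbox ha.
by exists (i, j); rewrite !mem_zbox.
Qed.

Lemma zbox2_uniq N : uniq (zbox2 N).
Proof. by apply: allpairs_uniq; rewrite ?zbox_uniq // => -[? ?] [? ?] _ _ [-> ->]. Qed.

Lemma big_zbox (V : nmodType) N (f : int -> V) :
  \sum_(j <- zbox N) f j = \sum_(k < N + N.+1) f (k%:Z - N%:Z).
Proof.
by rewrite big_map -(big_mkord xpredT (fun k => f (k%:Z - N%:Z))) /index_iota subn0.
Qed.

(** * Geometrically decaying sums over integer boxes *)

Section IntegerBoxes.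
Variable R : realType.
Local Notation C := R[i].
Variable rho : R.
Hypothesis rho01 : 0 <= rho < 1.

Let rhoX n : 0 <= rho ^+ n.
Proof. by rewrite exprn_ge0 //; case/andP: rho01. Qed.

Lemma zbox_geometric_le N :
  \sum_(j <- zbox N) rho ^+ `|j| <= 2 / (1 - rho).
Proof.
have /andP[r0 r1] := rho01.
rewrite big_zbox big_split_ord /=.
have -> : 2 / (1 - rho) = (1 - rho)^-1 + (1 - rho)^-1 by ring.
apply: lerD.
  rewrite (reindex_inj rev_ord_inj) /=.
  apply: le_trans (geometric_sum_le N rho01); apply: ler_sum => k _.
  have -> : absz ((N - k.+1)%N%:Z - N%:Z) = k.+1 by have := ltn_ord k; lia.
  by rewrite exprS ler_piMl // ltW.
apply: le_trans (geometric_sum_le N.+1 rho01); apply: ler_sum => k _.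
by rewrite PoszD addrAC subrr add0r.
Qed.

Lemma sum_sub_le (T : eqType) (s t : seq T) (g : T -> R) :
  uniq s -> uniq t -> {subset s <= t} -> (forall x, 0 <= g x) ->
  \sum_(x <- s) g x <= \sum_(x <- t) g x.
Proof.
move=> us ut st g0; rewrite [leRHS](bigID (mem s)) /= -[X in _ <= X + _]big_filter.
have -> : \sum_(x <- s) g x = \sum_(x <- [seq x <- t | x \in s]) g x.
  apply: perm_big; apply: uniq_perm => //; first exact: filter_uniq.
  by move=> x; rewrite mem_filter /=; case: (boolP (x \in s)) => // /st ->.
by rewrite lerDl sumr_ge0.
Qed.

(** Every finite set of pairs lies in a square box, over which the sum factors into two geometric
    sums. *)
Lemma double_geometric_le (s : seq (int * int)) : uniq s ->
  \sum_(x <- s) rho ^+ `|x.1| * rho ^+ `|x.2| <= (2 / (1 - rho)) ^+ 2.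
Proof.
move=> us.
pose L := \max_(x <- s) maxn `|x.1| `|x.2|.
have sL : {subset s <= zbox2 L}.
  move=> [i j] ijs; rewrite mem_zbox2.
  have := @leq_bigmax_seq _ s predT (fun x : int * int => maxn `|x.1| `|x.2|) _ ijs isT.
  by rewrite -/L /= geq_max.
apply: le_trans (sum_sub_le us (zbox2_uniq L) sL _) _.
  by move=> x; rewrite mulr_ge0.
rewrite big_allpairs /=.
under eq_bigr do rewrite -mulr_sumr.
rewrite -mulr_suml expr2; have h := zbox_geometric_le L.
by apply: ler_pM => //; rewrite sumr_ge0.
Qed.

(** Outside the box |i| or |j| exceeds M, so half of the exponent 2|i| + 2|j| supplies rho^M while
    the other half keeps the sum bounded. The list s is arbitrary in order to admit rotated
    boxes. *)
Lemma sum_zbox2_tail (g : int * int -> C) K M (s : seq (int * int)) :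
  (forall x, normc (g x) <= K * (rho ^+ (2 * `|x.1|) * rho ^+ (2 * `|x.2|))) ->
  uniq s -> {subset zbox2 M <= s} ->
  normc (\sum_(x <- s) g x - \sum_(x <- zbox2 M) g x)
    <= K * (2 / (1 - rho)) ^+ 2 * rho ^+ M.
Proof.
move=> hg us Ms; have /andP[r0 r1] := rho01.
have K0 : 0 <= K.
  by have := le_trans (normc_ge0 _) (hg (0, 0)); rewrite !muln0 !mulr1.
rewrite [X in normc (X - _)](bigID (mem (zbox2 M))) /= -[X in normc (X + _ - _)]big_filter.
have -> : \sum_(x <- [seq x <- s | x \in zbox2 M]) g x = \sum_(x <- zbox2 M) g x.
  apply: perm_big; apply: uniq_perm; rewrite ?filter_uniq ?zbox2_uniq // => x.
  by rewrite mem_filter /=; case: (boolP (x \in zbox2 M)) => // /Ms ->.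
rewrite addrAC subrr add0r; apply: le_trans (normc_sum _ _ _) _.
have h := double_geometric_le us.
rewrite mulrAC -!mulrA.
apply: (@le_trans _ _ (K * (rho ^+ M * \sum_(x <- s) rho ^+ `|x.1| * rho ^+ `|x.2|))); last first.
  by rewrite ler_wpM2l // ler_wpM2l.
rewrite !mulr_sumr [leRHS](bigID (mem (zbox2 M))) /= -[leLHS]add0r; apply: lerD.
  by apply: sumr_ge0 => x _; rewrite !mulr_ge0.
apply: ler_sum => -[i j]; rewrite mem_zbox2 => /= hij.
apply: le_trans (hg _) _ => /=; rewrite ler_wpM2l //.
rewrite -!exprD; apply: ler_wiXn2l => //; first exact: ltW.
lia.
Qed.

End IntegerBoxes.

(** * Jacobi triple product and the Weierstrass three-term relation *)

(** The exponent j (j - 1) / 2 of the triple product, a natural number for negative j as well: at j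
    = -(n + 1) it is C(n + 2, 2). *)
Definition tri (j : int) : nat :=
  match j with Posz n => 'C(n, 2) | Negz n => 'C(n.+2, 2) end.

Lemma bin2_double n : (2 * 'C(n, 2) + n = n * n)%N.
Proof. by elim: n => [|n IH] //; rewrite binS bin1; nia. Qed.

Lemma triE (j : int) : 2 * (tri j)%:Z = j * (j - 1).
Proof.
case: j => n; rewrite /tri ?NegzE.
  by have := bin2_double n; nia.
by have := bin2_double n.+2; nia.
Qed.

(* Rotated boxes: the pairs of equal parity, then those of opposite parity. *)
Definition bracket_range N : seq (int * int) :=
  [seq (s + D + 1, s - D + 1) | s <- zbox N, D <- zbox N] ++
  [seq (s + D + 1, s - D) | s <- zbox N, D <- zbox N].

Lemma bracket_range_uniq N : uniq (bracket_range N).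
Proof.
rewrite cat_uniq; apply/and3P; split.
- apply: allpairs_uniq; rewrite ?zbox_uniq // => -[a b] [c d] _ _ /= [h1 h2].
  by congr (_, _); lia.
- apply/hasPn => _ /allpairsP[[a b] /= [_ _ ->]].
  by apply/allpairsP => -[[c d] /= [_ _ [h1 h2]]]; lia.
- apply: allpairs_uniq; rewrite ?zbox_uniq // => -[a b] [c d] _ _ /= [h1 h2].
  by congr (_, _); lia.
Qed.

(** For i and j of equal parity, s = (i + j) / 2 - 1 can be as small as -N - 1; hence the range N +
    1. *)
Lemma bracket_range_sub N : {subset zbox2 N <= bracket_range N.+1}.
Proof.
move=> [i j]; rewrite mem_zbox2 => /andP[hi hj]; rewrite mem_cat.
have [h|h] : (exists D, i - j = 2 * D) \/ (exists D, i - j = 2 * D + 1).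
  have [h|h] : ((i - j) %% 2)%Z = 0 \/ ((i - j) %% 2)%Z = 1 by lia.
    by left; exists ((i - j) %/ 2)%Z; lia.
  by right; exists ((i - j) %/ 2)%Z; lia.
- case: h => D hD; apply/orP; left; apply/allpairsP.
  by exists (j + D - 1, D); rewrite !mem_zbox; split => /=; [lia|lia|congr (_, _); lia].
- case: h => D hD; apply/orP; right; apply/allpairsP.
  by exists (j + D, D); rewrite !mem_zbox; split => /=; [lia|lia|congr (_, _); lia].
Qed.

Section JacobiTripleProduct.
Variable R : realType.
Local Notation C := R[i].
Variable p : C.
Hypothesis p_neq0 : p != 0.
Hypothesis p_lt1 : normc p < 1.
Local Notation rho := (normc p).
Implicit Types (x y z : C).

Let rho01 : 0 <= rho < 1. Proof. by rewrite normc_ge0. Qed.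
Let rhoX n : 0 <= rho ^+ n. Proof. by rewrite exprn_ge0 ?normc_ge0. Qed.
Let rhoX1 n : rho ^+ n <= 1. Proof. by rewrite exprn_ile1 ?normc_ge0 // ltW. Qed.
Let rho_gt0 : 0 < rho. Proof. by rewrite normc_gt0. Qed.

(** Gaussian binomial coefficient in base p, defined by a Pascal rule so that no division occurs.
    The truncated subtraction is harmless: when k' > n' the coefficient it multiplies is 0. *)
Fixpoint qbinom (n k : nat) : C :=
  match n, k with
  | _, 0 => 1
  | 0, _.+1 => 0
  | n'.+1, k'.+1 => qbinom n' k'.+1 + p ^+ (n' - k') * qbinom n' k'
  end.

Lemma qbinom0 n : qbinom n 0 = 1. Proof. by case: n. Qed.

Lemma qbinomS n k :
  qbinom n.+1 k.+1 = qbinom n k.+1 + p ^+ (n - k) * qbinom n k.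
Proof. by []. Qed.

Lemma qbinom_small n k : (n < k)%N -> qbinom n k = 0.
Proof.
elim: n k => [|n IH] [|k] // nk.
by rewrite qbinomS !IH ?mulr0 ?addr0 //; lia.
Qed.

(** Induction with the Pascal rule: by [eS] the terms with shifted index reproduce the expansion
    multiplied by - z p^n, which is the contribution of the new factor 1 - z p^n. *)
Lemma qbinomial_theorem z n :
  qpoch p z n = \sum_(k < n.+1) qbinom n k * ((-1) ^+ k * p ^+ 'C(k, 2) * z ^+ k).
Proof.
elim: n => [|n IH].
  by rewrite /qpoch big_ord0 big_ord_recl big_ord0 /= !mulr1 addr0.
pose e k := (-1) ^+ k * p ^+ 'C(k, 2) * z ^+ k.
have eS k : (k <= n)%N -> p ^+ (n - k) * e k.+1 = - (z * p ^+ n) * e k.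
  move=> kn; rewrite /e binS bin1 exprD -{2}(subnK kn) exprD !exprS; ring.
rewrite qpochS IH -/(e _) mulrBr mulr1.
rewrite [in RHS]big_ord_recl [in RHS]qbinom0.
under [in RHS]eq_bigr => k _ do rewrite lift0.
rewrite -/(e 0%N).
under [in RHS]eq_bigr => k _ do
  rewrite -/(e k.+1) qbinomS mulrDl (mulrAC (p ^+ _)) eS -1?ltnS //.
rewrite big_split /= addrA; congr (_ + _); last first.
  rewrite mulr_suml -sumrN; apply: eq_bigr => k _; rewrite -/(e k); ring.
transitivity (\sum_(k < n.+2) qbinom n k * e k).
  by rewrite [RHS]big_ord_recr /= qbinom_small // mul0r addr0.
by rewrite big_ord_recl qbinom0; under [in LHS]eq_bigr => k _ do rewrite lift0.
Qed.

(** The quotient formula for Gaussian binomials, cleared of denominators. The induction is on a + b,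
    since the Pascal rule lowers either a or b. *)
Lemma qbinomE a b :
  qbinom (a + b) a * (qpoch p p a * qpoch p p b) = qpoch p p (a + b).
Proof.
have [n] := ubnP (a + b); elim: n a b => // n IH [|a] [|b] hn.
- by rewrite /= /qpoch big_ord0 !mul1r.
- by rewrite !add0n qbinom0 /qpoch big_ord0 !mul1r.
- rewrite addn0 qbinomS qbinom_small // add0r subnn expr0 mul1r.
  have h : qbinom a a * (qpoch p p a * qpoch p p 0) = qpoch p p a.
    by have := IH a 0%N; rewrite addn0 => -> //; lia.
  by rewrite !qpochS -[in RHS]h; ring.
- have h1 : qbinom (a + b.+1) a.+1 * (qpoch p p a.+1 * qpoch p p b) =
      qpoch p p (a + b.+1) by have := IH a.+1 b; rewrite addSnnS => -> //; lia.
  have h2 := IH a b.+1.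
  rewrite addSn qbinomS (qpochS _ _ (a + b.+1)).
  have -> : (a + b.+1 - a)%N = b.+1 by lia.
  have -> : forall A B' : C, (A + B') * (qpoch p p a.+1 * qpoch p p b.+1) =
     A * (qpoch p p a.+1 * qpoch p p b) * (1 - p * p ^+ b) +
     B' * (qpoch p p a * qpoch p p b.+1) * (1 - p * p ^+ a).
    by move=> A B'; rewrite !qpochS; ring.
  rewrite h1 -[X in _ + X * _]mulrA h2; last by lia.
  rewrite exprD !exprS; ring.
Qed.

Lemma qpoch_cat x m n : qpoch p x (m + n) = qpoch p x m * qpoch p (x * p ^+ m) n.
Proof.
rewrite /qpoch big_split_ord /=; congr (_ * _).
by apply: eq_bigr => l _; rewrite exprD mulrA.
Qed.

(** Each factor is turned around by 1 - x p^(-l) = - x p^(-l) (1 - p^l / x), for l from 1 to n. *)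
Lemma qpoch_reverse x n : x != 0 ->
  qpoch p (x / p ^+ n) n * p ^+ 'C(n.+1, 2) = (- x) ^+ n * qpoch p (p / x) n.
Proof.
move=> x0; elim: n => [|n IH].
  by rewrite /qpoch !big_ord0 !mulr1.
rewrite qpoch_shift qpochS binS bin1 exprD.
have -> : x / p ^+ n.+1 * p = x / p ^+ n.
  by rewrite exprS; field; rewrite p_neq0 expf_neq0.
have -> : (1 - x / p ^+ n.+1) * qpoch p (x / p ^+ n) n *
    (p ^+ 'C(n.+1, 2) * p ^+ n.+1) =
  (p ^+ n.+1 - x) * (qpoch p (x / p ^+ n) n * p ^+ 'C(n.+1, 2)).
  by field; rewrite expf_neq0.
rewrite IH !exprS; field; exact: x0.
Qed.

Definition jterm z (j : int) : C := (-1) ^ j * p ^+ tri j * z ^ j.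

Definition jsum z N : C := \sum_(j <- zbox N) jterm z j.

(** Finite form of the triple product: the q-binomial theorem for the 2N factors starting at z
    p^(-N), of which the first N are reversed into those of p / z. *)
Lemma finite_jacobi z N : z != 0 ->
  qpoch p z N * qpoch p (p / z) N =
  \sum_(k < N + N.+1) qbinom (N + N) k * jterm z (k%:Z - N%:Z).
Proof.
move=> z0.
have pX n : p ^+ n != 0 by rewrite expf_neq0.
have nz0 : (- z) ^+ N != 0 by rewrite expf_neq0 // oppr_eq0.
apply: (mulfI nz0).
rewrite mulrCA -qpoch_reverse // mulrA.
have -> : qpoch p z N * qpoch p (z / p ^+ N) N = qpoch p (z / p ^+ N) (N + N).
  by rewrite qpoch_cat mulfVK // mulrC.
rewrite qbinomial_theorem mulr_suml mulr_sumr addnS; apply: eq_bigr => k _.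
rewrite -[LHS]mulrA [RHS]mulrCA; congr (_ * _).
rewrite /jterm.
have e1 : p ^+ 'C(k, 2) * p ^+ 'C(N.+1, 2) =
    p ^+ tri (k%:Z - N%:Z) * p ^+ (N * k).
  rewrite -!exprD; congr (_ ^+ _).
  have := triE (k%:Z - N%:Z); have := bin2_double k; have := bin2_double N.+1.
  nia.
have e2 (w : C) : w != 0 -> w ^+ k = w ^ (k%:Z - N%:Z) * w ^+ N.
  by move=> w0; rewrite -[w ^+ N]/(w ^ N%:Z) -expfzDr // subrK.
have m1 : (-1 : C) != 0 by rewrite oppr_eq0 oner_eq0.
rewrite expr_div_n (e2 z) // (e2 (-1)) // -exprM (exprNn z N).
transitivity (((-1) ^ (k%:Z - N%:Z) * (-1) ^+ N * z ^ (k%:Z - N%:Z) * z ^+ N) *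
  (p ^+ 'C(k, 2) * p ^+ 'C(N.+1, 2)) / p ^+ (N * k)); first by ring.
rewrite e1; field; exact: pX.
Qed.

(** Consecutive terms have ratio w rho^i, at most 1 from i = N on; up to there each term is bounded
    by the sum of the first N + 1. *)
Lemma superexponential_bound (w : R) : 0 <= w ->
  exists K, forall i : nat, rho ^+ 'C(i, 2) * w ^+ i <= K.
Proof.
move=> w0; pose a i := rho ^+ 'C(i, 2) * w ^+ i.
have a0 i : 0 <= a i by rewrite mulr_ge0 ?exprn_ge0 ?normc_ge0.
have [N hN] := geometric_small w rho01 (@ltr01 R).
exists (\sum_(l < N.+1) a l) => i; rewrite -/(a i).
elim: i => [|i IH].
  by rewrite big_ord_recl lerDl sumr_ge0.
have [iN|Ni] := ltnP i N; last first.
  apply: le_trans IH; have -> : a i.+1 = a i * (w * rho ^+ i).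
    by rewrite /a binS bin1 exprD exprS; ring.
  by rewrite ler_piMr // hN.
rewrite (bigD1 (Ordinal (iN : (i.+1 < N.+1)%N))) //= lerDl sumr_ge0 //.
Qed.

(** The quadratic exponent beats every geometric rate. The rate rho^2 is chosen because [theta_jsum]
    and [sum_zbox2_tail] spend one factor rho^|j| on smallness and another on summability. *)
Lemma jterm_decay z : z != 0 ->
  exists K, forall j, normc (jterm z j) <= K * rho ^+ (2 * `|j|).
Proof.
move=> z0; have nz : 0 < normc z by rewrite normc_gt0.
have [K1 h1] := @superexponential_bound (normc z / rho ^+ 2)
  ltac:(by rewrite divr_ge0 // normc_ge0).
have [K2 h2] := @superexponential_bound (rho / normc z / rho ^+ 2)
   ltac:(by rewrite !divr_ge0 // normc_ge0).
have K10 : 0 <= K1 by apply: le_trans (h1 0%N); rewrite mulr1.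
have K20 : 0 <= K2 by apply: le_trans (h2 0%N); rewrite mulr1.
have nm (i : int) : normc ((-1 : C) ^ i) = 1.
  by case: i => n; rewrite ?NegzE /exprz ?normcV normcX normcNE normc1 expr1n ?invr1.
have rne : rho != 0 by rewrite gt_eqF.
exists (K1 + K2) => j; rewrite /jterm !normcM nm mul1r normcX.
case: j => n /=.
  apply: (@le_trans _ _ (K1 * rho ^+ (2 * n))); last first.
    by rewrite ler_wpM2r // lerDl.
  apply: le_trans (_ : _ <= rho ^+ 'C(n, 2) * (normc z / rho ^+ 2) ^+ n * rho ^+ (2 * n)) _; last first.
    by rewrite ler_wpM2r.
  rewrite -[z ^ n]/(z ^+ n) normcX expr_div_n exprM -!mulrA mulVf ?mulr1 //.
  by rewrite !expf_neq0.
apply: (@le_trans _ _ (K2 * rho ^+ (2 * n.+1))); last first.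
  by rewrite ler_wpM2r // lerDr.
apply: le_trans (_ : _ <= rho ^+ 'C(n.+1, 2) * (rho / normc z / rho ^+ 2) ^+ n.+1 * rho ^+ (2 * n.+1)) _; last first.
  by rewrite ler_wpM2r.
rewrite -[z ^ Negz n]/((z ^+ n.+1)^-1) normcV normcX (binS n.+1) bin1 exprD.
rewrite !expr_div_n exprM -[X in _ <= X]mulrA mulfVK ?expf_neq0 //.
by rewrite -!mulrA lexx.
Qed.

(** * Passage to the limit in the triple product *)

Local Notation Pinf := (qpoch_inf p p).

Lemma qpochpp_neq0 : Pinf != 0.
Proof.
apply/eqP => /(qpoch_inf_eq0 p_lt1)[l].
rewrite -exprS => /(congr1 (@normc R)); rewrite normcX normc1 exprS => h.
have : rho * rho ^+ l <= rho by rewrite ler_piMr ?normc_ge0.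
by rewrite h leNgt p_lt1.
Qed.

(** The nonzero limit is the n-th partial product times a tail, and the tails are bounded above
    uniformly in n. *)
Lemma qpochpp_lower : exists2 d, 0 < d & forall n, d <= normc (qpoch p p n).
Proof.
have M1 : 0 < majorant_inf p 1 by exact: expR_gt0.
exists (normc Pinf / majorant_inf p 1) => [|n].
  by rewrite divr_gt0 // normc_gt0 qpochpp_neq0.
rewrite ler_pdivrMr // (qpoch_inf_split p_lt1 p n) normcM.
rewrite ler_wpM2l ?normc_ge0 //.
have yle : normc (p * p ^+ n) <= 1 by rewrite -exprS normcX.
have h : forall N, normc (qpoch_inf (p * p ^+ n) p) - majorant_inf p 1 <=
    qpoch_rate p 1 * rho ^+ N.
  move=> N; have h1 := qpoch_inf_approx p_lt1 N yle.
  have h2 := le_trans (qpoch_norm_le p N yle) (majorant_le p_lt1 N ler01).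
  have := normc_ler_sub (qpoch_inf (p * p ^+ n) p) (qpoch p (p * p ^+ n) N).
  rewrite normc_distC; lra.
by have := le0_geometric rho01 h; rewrite subr_le0.
Qed.

(** In the quotient formula (p)_(a+b) is close to (p)_a and (p)_b is close to the infinite product;
    [qpochpp_lower] permits the division. *)
Lemma qbinom_approx : exists K, forall a b,
  normc (qbinom (a + b) a * Pinf - 1) <= K * (rho ^+ a + rho ^+ b).
Proof.
have [d d0 hd] := qpochpp_lower.
pose Q := qpoch_rate p 1; pose M := majorant_inf p 1.
have p1 : rho <= 1 := ltW p_lt1.
have M1 : 1 <= M by exact: majorant_inf_ge1.
have Q0 : 0 <= Q.
  by rewrite /Q /qpoch_rate divr_ge0 ?subr_ge0 // mulr_ge0 // mul1r; exact: le_trans M1.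
have hQ n : normc (qpoch p p n - Pinf) <= Q * rho ^+ n by exact: qpoch_inf_approx.
have hM n : normc (qpoch p p n) <= M.
  exact: le_trans (qpoch_norm_le p n p1) (majorant_le p_lt1 n ler01).
have hP : normc Pinf <= M + Q.
  have h1 := hQ 0%N; have h2 := hM 0%N.
  have := normc_ler_sub Pinf (qpoch p p 0); rewrite normc_distC.
  move: h1; rewrite mulr1; lra.
exists ((2 * Q * (M + Q) + M * Q) / d ^+ 2) => a b.
have P0 n : qpoch p p n != 0 by rewrite -normc_gt0; exact: lt_le_trans (hd n).
have eqn : (qbinom (a + b) a * Pinf - 1) * (qpoch p p a * qpoch p p b) =
   (qpoch p p (a + b) - qpoch p p a) * Pinf + qpoch p p a * (Pinf - qpoch p p b).
  by rewrite -qbinomE; ring.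
have dab : d ^+ 2 <= normc (qpoch p p a * qpoch p p b).
  by rewrite normcM expr2; apply: ler_pM => //; exact: ltW.
rewrite mulrAC ler_pdivlMr ?exprn_gt0 //.
apply: (@le_trans _ _ (normc ((qbinom (a + b) a * Pinf - 1) *
   (qpoch p p a * qpoch p p b)))).
  by rewrite [leRHS]normcM ler_wpM2l ?normc_ge0.
rewrite eqn; apply: le_trans (normcD _ _) _; rewrite !normcM.
have hab : normc (qpoch p p (a + b) - qpoch p p a) <= 2 * Q * rho ^+ a.
  apply: le_trans (normc_dist _ _ Pinf) _; rewrite [X in _ + X]normc_distC.
  have h1 := hQ (a + b)%N; have h2 := hQ a.
  have h3 : Q * rho ^+ (a + b) <= Q * rho ^+ a.
    by rewrite ler_wpM2l // exprD ler_piMr.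
  lra.
have hb : normc (Pinf - qpoch p p b) <= Q * rho ^+ b by rewrite normc_distC.
apply: (@le_trans _ _ ((2 * Q * rho ^+ a) * (M + Q) + M * (Q * rho ^+ b))).
  by apply: lerD; apply: ler_pM; rewrite ?normc_ge0.
have M0 : 0 <= M by exact: le_trans ler01 M1.
have ra := rhoX a; have rb := rhoX b.
have h1 : 0 <= 2 * Q * (M + Q) * rho ^+ b.
  by apply: mulr_ge0 rb; apply: mulr_ge0; [exact: mulr_ge0 | exact: addr_ge0].
have h2 : 0 <= M * Q * rho ^+ a by apply: mulr_ge0 ra; exact: mulr_ge0.
have -> : (2 * Q * (M + Q) + M * Q) * (rho ^+ a + rho ^+ b) =
  (2 * Q * rho ^+ a) * (M + Q) + M * (Q * rho ^+ b) +
  2 * Q * (M + Q) * rho ^+ b + M * Q * rho ^+ a by ring.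
lra.
Qed.

(** Near the ends of the box k or 2N - k is small and [qbinom_approx] is weak, but there the decay
    of [jterm] compensates: with j = k - N, both |j| + k and |j| + 2N - k are at least N. *)
Lemma theta_jsum z : z != 0 -> geo_approx rho (jsum z) (theta z p * Pinf).
Proof.
move=> z0.
have apx y : geo_approx rho (qpoch p y) (qpoch_inf y p).
  by exists (qpoch_rate p (normc y)) => N; exact: qpoch_inf_approx.
apply: (@geo_approx_trans _ rho (fun N => qpoch p z N * qpoch p (p / z) N * Pinf)).
  apply: geo_approxM => //; last exact: geo_approx_cst.
  exact: geo_approxM.
have [K hK] := jterm_decay z0; have [L hL] := qbinom_approx.
have K0 : 0 <= K by have := le_trans (normc_ge0 _) (hK 0); rewrite mulr1.
have L0 : 0 <= L.
  have := le_trans (normc_ge0 _) (hL 0%N 0%N); rewrite !expr0.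
  by rewrite pmulr_lge0 //; lra.
exists (K * (2 * L) * (2 / (1 - rho))) => N.
rewrite finite_jacobi // /jsum big_zbox mulr_suml -sumrB.
apply: le_trans (normc_sum _ _ _) _.
rewrite mulrAC; apply: le_trans (_ : K * (2 * L) * rho ^+ N *
   (\sum_(j <- zbox N) rho ^+ `|j|) <= _); last first.
  by rewrite ler_wpM2l ?mulr_ge0 // zbox_geometric_le.
rewrite big_zbox mulr_sumr; apply: ler_sum => k _.
set j : int := k%:Z - N%:Z.
have -> : jterm z j - qbinom (N + N) k * jterm z j * Pinf =
  - (jterm z j * (qbinom (N + N) k * Pinf - 1)) by ring.
have kN : (k <= N + N)%N by have := ltn_ord k; lia.
have := hL k (N + N - k)%N; rewrite subnKC // => hLk.
rewrite normcNE normcM.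
apply: (@le_trans _ _ ((K * rho ^+ (2 * `|j|)) *
   (L * (rho ^+ k + rho ^+ (N + N - k))))).
  by apply: ler_pM; rewrite ?normc_ge0.
have -> : K * rho ^+ (2 * `|j|) * (L * (rho ^+ k + rho ^+ (N + N - k))) =
  K * L * rho ^+ `|j| * (rho ^+ (`|j| + k) + rho ^+ (`|j| + (N + N - k))).
  by rewrite mul2n -addnn !exprD; ring.
have -> : K * (2 * L) * rho ^+ N * rho ^+ `|j| =
  K * L * rho ^+ `|j| * (rho ^+ N + rho ^+ N) by ring.
rewrite ler_wpM2l ?mulr_ge0 //; apply: lerD.
  by apply: ler_wiXn2l; rewrite ?normc_ge0 ?(ltW p_lt1) // /j; lia.
by apply: ler_wiXn2l; rewrite ?normc_ge0 ?(ltW p_lt1) // /j; lia.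
Qed.

(** * Products of two thetas as determinants *)

Definition even_sum y N : C := \sum_(D <- zbox N) p ^ (D * D) * y ^ (2 * D).
Definition odd_sum y N : C := \sum_(D <- zbox N) p ^ (D * D + D) * y ^ (2 * D + 1).

Definition bracket x y N : C :=
  odd_sum x N * even_sum y N - even_sum x N * odd_sum y N.

Lemma jterm_mul x y (i j : int) : x != 0 -> y != 0 ->
  jterm (x * y) i * jterm (x / y) j =
  (-1) ^ (i + j) * p ^ ((tri i)%:Z + (tri j)%:Z) * x ^ (i + j) * y ^ (i - j).
Proof.
move=> x0 y0; rewrite /jterm -![p ^+ _]/(p ^ _%:Z) !expfzMl.
have m1 : (-1 : C) != 0 by rewrite oppr_eq0 oner_eq0.
have -> : y^-1 ^ j = y ^ (- j) by rewrite exprz_inv.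
rewrite !expfzDr //.
by move: ((-1) ^ i) ((-1) ^ j) (p ^ _) (p ^ _) (x ^ _) (x ^ _) (y ^ _) (y ^ _) => *; ring.
Qed.

Lemma exprN1_double (s : int) : (-1 : C) ^ (2 * s) = 1.
Proof. by rewrite -exprz_exp -[(-1) ^ 2]/((-1) ^+ 2) sqrrN expr1n exp1rz. Qed.

(** The variables s and D diagonalise the quadratic exponent, so the term splits into a part in x
    and s and a part in y and D. The shift by 1 is arranged so that both parities leave the same
    prefactor x. *)
Lemma jterm_even x y (s D : int) : x != 0 -> y != 0 ->
  jterm (x * y) (s + D + 1) * jterm (x / y) (s - D + 1) =
  x * (p ^ (s * s + s) * x ^ (2 * s + 1)) * (p ^ (D * D) * y ^ (2 * D)).
Proof.
move=> x0 y0; rewrite jterm_mul //.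
have -> : s + D + 1 + (s - D + 1) = 2 * (s + 1) by ring.
have -> : s + D + 1 - (s - D + 1) = 2 * D by ring.
have -> : (tri (s + D + 1))%:Z + (tri (s - D + 1))%:Z = s * s + s + D * D.
  by have := triE (s + D + 1); have := triE (s - D + 1); nia.
rewrite exprN1_double; have -> : 2 * (s + 1) = 1 + (2 * s + 1) by ring.
rewrite (expfzDr _ (2 * s + 1)) // (expfzDr _ (D * D)) // expr1z.
by move: (p ^ _) (p ^ _) (x ^ _) (y ^ _) => a b c d; ring.
Qed.

Lemma jterm_odd x y (s D : int) : x != 0 -> y != 0 ->
  jterm (x * y) (s + D + 1) * jterm (x / y) (s - D) =
  - (x * (p ^ (s * s) * x ^ (2 * s)) * (p ^ (D * D + D) * y ^ (2 * D + 1))).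
Proof.
move=> x0 y0; rewrite jterm_mul //.
have m1 : (-1 : C) != 0 by rewrite oppr_eq0 oner_eq0.
have -> : s + D + 1 + (s - D) = 2 * s + 1 by ring.
have -> : s + D + 1 - (s - D) = 2 * D + 1 by ring.
have -> : (tri (s + D + 1))%:Z + (tri (s - D))%:Z = s * s + (D * D + D).
  by have := triE (s + D + 1); have := triE (s - D); nia.
rewrite [(-1) ^ _]expfzDr // exprN1_double expr1z.
rewrite [x ^ _]expfzDr // (expfzDr _ (D * D + D)) // expr1z.
by move: (p ^ _) (p ^ _) (x ^ _) (y ^ _) => a b c d; ring.
Qed.

Lemma bracket_sumE x y N : x != 0 -> y != 0 ->
  x * bracket x y N =
  \sum_(e <- bracket_range N) jterm (x * y) e.1 * jterm (x / y) e.2.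
Proof.
move=> x0 y0; rewrite /bracket /bracket_range big_cat !big_allpairs_dep /=.
have sep (c : C) (u v : int -> C) :
    \sum_(s <- zbox N) \sum_(D <- zbox N) c * u s * v D =
    c * (\sum_(s <- zbox N) u s) * \sum_(D <- zbox N) v D.
  by under eq_bigr do rewrite -mulr_sumr; rewrite -mulr_suml -mulr_sumr.
transitivity (x * odd_sum x N * even_sum y N + (- x) * even_sum x N * odd_sum y N).
  by rewrite mulrBr !mulNr !mulrA.
rewrite -!sep; congr (_ + _); apply: eq_bigr => s _; apply: eq_bigr => D _.
  by rewrite jterm_even.
by rewrite jterm_odd // !mulNr.
Qed.

Lemma theta_bracket x y : x != 0 -> y != 0 ->
  geo_approx rho (fun N => x * bracket x y N.+1)
    (theta (x * y) p * theta (x / y) p * Pinf ^+ 2).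
Proof.
move=> x0 y0.
have xy0 : x * y != 0 by rewrite mulf_neq0.
have xVy0 : x / y != 0 by rewrite mulf_neq0 ?invr_eq0.
have [K hK] := jterm_decay xy0; have [L hL] := jterm_decay xVy0.
have -> : theta (x * y) p * theta (x / y) p * Pinf ^+ 2 =
  (theta (x * y) p * Pinf) * (theta (x / y) p * Pinf) by ring.
apply: (@geo_approx_trans _ rho (fun N => jsum (x * y) N * jsum (x / y) N)).
  by apply: geo_approxM => //; exact: theta_jsum.
exists (K * L * (2 / (1 - rho)) ^+ 2) => N.
rewrite bracket_sumE //.
have -> : jsum (x * y) N * jsum (x / y) N =
  \sum_(e <- zbox2 N) jterm (x * y) e.1 * jterm (x / y) e.2.
  by rewrite big_allpairs /= /jsum mulr_suml; apply: eq_bigr => i _; rewrite mulr_sumr.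
apply: sum_zbox2_tail => //.
- move=> [i j] /=; rewrite normcM.
  have -> : K * L * (rho ^+ (2 * `|i|) * rho ^+ (2 * `|j|)) =
    (K * rho ^+ (2 * `|i|)) * (L * rho ^+ (2 * `|j|)) by ring.
  by apply: ler_pM; rewrite ?normc_ge0.
- exact: bracket_range_uniq.
- exact: bracket_range_sub.
Qed.

Lemma theta_three_term x y u v : x != 0 -> y != 0 -> u != 0 -> v != 0 ->
  theta (x * y) p * theta (x / y) p * (theta (u * v) p * theta (u / v) p) -
  theta (x * v) p * theta (x / v) p * (theta (u * y) p * theta (u / y) p) =
  u / y * (theta (y * v) p * theta (y / v) p *
           (theta (x * u) p * theta (x / u) p)).
Proof.
move=> x0 y0 u0 v0.
(* Every product in the relation has four thetas, and the triple product attaches one [Pinf] to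
   each. *)
have P4 : Pinf ^+ 4 != 0 by rewrite expf_neq0 // qpochpp_neq0.
apply: (mulIf P4).
have h a b c d : a != 0 -> b != 0 -> c != 0 -> d != 0 ->
  geo_approx rho (fun N => a * c * (bracket a b N.+1 * bracket c d N.+1))
    (theta (a * b) p * theta (a / b) p * (theta (c * d) p * theta (c / d) p) *
     Pinf ^+ 4).
  move=> a0 b0 c0 d0.
  have := geo_approxM rho01 (theta_bracket a0 b0) (theta_bracket c0 d0).
  congr (geo_approx _ _ _); last by ring.
  by apply/funext => N; rewrite mulrACA.
have lhs := geo_approxB (h x y u v x0 y0 u0 v0) (h x v u y x0 v0 u0 y0).
have rhs := geo_approxM rho01 (geo_approx_cst rho (u / y)) (h y v x u y0 v0 x0 u0).
rewrite mulrBl -[RHS]mulrA; apply: (geo_approx_uniq rho01 lhs).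
move: rhs; congr (geo_approx _ _ _).
(* At each N, with the truncated sums as free variables, this is the relation between the 2 x 2
   minors of a 2 x 4 matrix. *)
apply/funext => N; rewrite /bracket.
move: (odd_sum x _) (odd_sum y _) (odd_sum u _) (odd_sum v _).
move: (even_sum x _) (even_sum y _) (even_sum u _) (even_sum v _).
by move=> *; field; exact: y0.
Qed.

End JacobiTripleProduct.

(** * Telescoping over the lattice rectangle *)

Ltac nonzero := repeat first
  [ assumption | apply: mulf_neq0 | apply: invr_neq0 | apply: expf_neq0 ].

Section Telescoping.
Variable F : fieldType.
Variable th : F -> F.
(** The telescoping is pure algebra over a field: theta enters only through its zero at 1, its
    inversion formula and the three-term relation. *)
Hypothesis th1 : th 1 = 0.
Hypothesis thV : forall x, x != 0 -> th x^-1 = - x^-1 * th x.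
Hypothesis th3 : forall z al be ga, z != 0 -> al != 0 -> be != 0 -> ga != 0 ->
  th (z / al) * th al * (th (z / (be * ga)) * th (be / ga)) -
  th (z / be) * th be * (th (z / (al * ga)) * th (al / ga)) =
  al / ga * (th (z / (al * be)) * th (be / al) * (th (z / ga) * th ga)).

Variables q a b c x : F.
Hypotheses (q0 : q != 0) (a0 : a != 0) (b0 : b != 0) (c0 : c != 0) (x0 : x != 0).

(** Balance for leaving a lattice point (n, k), with Q = q^n and K = q^k. *)
Lemma three_term_sum Q K : Q != 0 -> K != 0 ->
  th (c / a * Q) * th (b * x * Q) * th (b / x * Q) * th (a * c * (Q * K * K)) * K -
  b / a * (th (c / b * K) * th (a * x * K) * th (a / x * K) *
           th (b * c * (K * Q * Q)) * Q) =
  K * (th (a * b * (Q * K)) * th (b * Q / (a * K)) * th (c * x * (Q * K)) *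
       th (c / x * (Q * K))).
Proof.
move=> Q0 K0.
(* The parameters solve z / al = b x Q, al = b Q / x, be / ga = c Q / a and z / (be ga) = a c Q K^2,
   the arguments of the first product. *)
have := @th3 ((b * Q) ^+ 2) (b * Q / x) (b * Q / (a * K)) (b / (c * K))
  ltac:(nonzero) ltac:(nonzero) ltac:(nonzero) ltac:(nonzero).
have -> : (b * Q) ^+ 2 / (b * Q / x) = b * x * Q by field; do ?[apply/andP; split]; nonzero.
have -> : (b * Q) ^+ 2 / (b * Q / (a * K) * (b / (c * K))) =
  a * c * (Q * K * K) by field; do ?[apply/andP; split]; nonzero.
have -> : b * Q / (a * K) / (b / (c * K)) = c / a * Q.
  by field; do ?[apply/andP; split]; nonzero.
have -> : (b * Q) ^+ 2 / (b * Q / (a * K)) = a * b * (Q * K).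
  by field; do ?[apply/andP; split]; nonzero.
have -> : (b * Q) ^+ 2 / (b * Q / x * (b / (c * K))) = c * x * (Q * K).
  by field; do ?[apply/andP; split]; nonzero.
have -> : b * Q / x / (b / (c * K)) = c / x * (Q * K).
  by field; do ?[apply/andP; split]; nonzero.
have -> : (b * Q) ^+ 2 / (b * Q / x * (b * Q / (a * K))) = a * x * K.
  by field; do ?[apply/andP; split]; nonzero.
have -> : b * Q / (a * K) / (b * Q / x) = (a / x * K)^-1.
  by field; do ?[apply/andP; split]; nonzero.
have -> : (b * Q) ^+ 2 / (b / (c * K)) = b * c * (K * Q * Q).
  by field; do ?[apply/andP; split]; nonzero.
have -> : b / (c * K) = (c / b * K)^-1 by field; do ?[apply/andP; split]; nonzero.
have -> : b * Q / x = b / x * Q by field; nonzero.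
have e1 : a / x * K != 0 by nonzero.
have e2 : c / b * K != 0 by nonzero.
rewrite (thV e1) (thV e2).
move: (th (b * x * Q)) (th (b / x * Q)) (th (a * c * _)) (th (c / a * Q))
  (th (a * b * _)) (th (b * Q / _)) (th (c * x * _)) (th (c / x * _))
  (th (a * x * K)) (th (a / x * K)) (th (b * c * _)) (th (c / b * K)).
move=> t1 t2 t3 t4 t5 t6 t7 t8 t9 t10 t11 t12 h.
have h' : t5 * t6 * (t7 * t8) = t1 * t2 * (t3 * t4) - c / x * (Q * K) *
   (t9 * (- (a / x * K)^-1 * t10) * (t11 * (- (c / b * K)^-1 * t12))).
  by rewrite -h; ring.
transitivity (K * (t5 * t6 * (t7 * t8))); last by ring.
by rewrite h'; field; do ?[apply/andP; split]; nonzero.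
Qed.

(** Balance for arriving at (n, k), with Q = q^n and K = q^k; the divisions by q come from the two
    preceding points. At Q = 1 or K = 1 one arrival term vanishes, which settles the boundary of the
    rectangle. *)
Lemma three_term_step Q K : Q != 0 -> K != 0 ->
  th Q * th (b * c * (Q / q)) * th (b / a * Q) * th (a * c * (Q / q * K * K)) * K -
  b / a * (th K * th (a * c * (K / q)) * th (a / b * K) *
           th (b * c * (K / q * Q * Q)) * Q) =
  th (Q * K) * th (a * c * (Q * K / q)) * th (b * c * (Q * K / q)) * K *
    th (b * Q / (a * K)).
Proof.
move=> Q0 K0.
have := @th3 (b * c * (Q * Q * K * K / q)) (b / a * Q) K (Q * K)
  ltac:(nonzero) ltac:(nonzero) ltac:(nonzero) ltac:(nonzero).
have -> : b * c * (Q * Q * K * K / q) / (b / a * Q) = a * c * (Q / q * K * K).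
  by field; do ?[apply/andP; split]; nonzero.
have -> : b * c * (Q * Q * K * K / q) / (K * (Q * K)) = b * c * (Q / q).
  by field; do ?[apply/andP; split]; nonzero.
have -> : K / (Q * K) = Q^-1 by field; do ?[apply/andP; split]; nonzero.
have -> : b * c * (Q * Q * K * K / q) / K = b * c * (K / q * Q * Q).
  by field; do ?[apply/andP; split]; nonzero.
have -> : b * c * (Q * Q * K * K / q) / (b / a * Q * (Q * K)) = a * c * (K / q).
  by field; do ?[apply/andP; split]; nonzero.
have -> : b / a * Q / (Q * K) = (a / b * K)^-1 by field; do ?[apply/andP; split]; nonzero.
have -> : b * c * (Q * Q * K * K / q) / (b / a * Q * K) = a * c * (Q * K / q).
  by field; do ?[apply/andP; split]; nonzero.
have -> : K / (b / a * Q) = (b * Q / (a * K))^-1 by field; do ?[apply/andP; split]; nonzero.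
have -> : b * c * (Q * Q * K * K / q) / (Q * K) = b * c * (Q * K / q).
  by field; do ?[apply/andP; split]; nonzero.
have e1 : a / b * K != 0 by nonzero.
have e2 : b * Q / (a * K) != 0 by nonzero.
rewrite (thV e1) (thV e2) (thV Q0).
move: (th Q) (th K) (th (b * c * (Q / q))) (th (b / a * Q))
  (th (a * c * (Q / q * K * K))) (th (a * c * (K / q))) (th (a / b * K))
  (th (b * c * (K / q * Q * Q))) (th (Q * K)) (th (a * c * (Q * K / q)))
  (th (b * c * (Q * K / q))) (th (b * Q / (a * K))).
move=> t1 t2 t3 t4 t5 t6 t7 t8 t9 t10 t11 t12 h.
transitivity (- (Q * K) * (t5 * t4 * (t3 * (- Q^-1 * t1)) -
  t8 * t2 * (t6 * (- (a / b * K)^-1 * t7)))).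
  by field; do ?[apply/andP; split]; nonzero.
by rewrite h; field; do ?[apply/andP; split]; nonzero.
Qed.

(** * Weights of the lattice paths *)

Definition fac z k : F := \prod_(l < k) th (z * q ^+ l).
Definition ifac z k : F := \prod_(l < k) (th (z * q ^+ l))^-1.

Lemma facS z k : fac z k.+1 = fac z k * th (z * q ^+ k).
Proof. by rewrite /fac big_ord_recr. Qed.

Lemma ifacS z k : ifac z k.+1 = ifac z k / th (z * q ^+ k).
Proof. by rewrite /ifac big_ord_recr. Qed.

(* Common factor of the weights at (n, k).  The lengths i and j, equal to n + k
   or (n + k).+1, are separate parameters so that no numerator factor ever has
   to be cancelled. *)
Definition weight n k i j : F :=
  fac q i * fac (a * c) i * fac (b * c) i *
  (fac (c / a) n * fac (b * x) n * fac (b / x) n) *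
  (fac (c / b) k * fac (a * x) k * fac (a / x) k) *
  (ifac (a * b) j * ifac (c * x) j * ifac (c / x) j) *
  (ifac q n * ifac (b * c) n * ifac (b * q / a) n) *
  (ifac q k * ifac (a * c) k * ifac (a * q / b) k) / th (b / a).

Definition exit_right n k : F :=
  weight n k (n + k) (n + k).+1 *
  (th (c / a * q ^+ n) * th (b * x * q ^+ n) * th (b / x * q ^+ n) *
   th (a * c * (q ^+ n * q ^+ k * q ^+ k)) * q ^+ k).

(** This is [exit_right] with a, b and n, k exchanged, as [exit_swap] confirms. The factor - b / a
    turns 1 / th (a / b) into 1 / th (b / a), so that both exits share one [weight]. *)
Definition exit_up n k : F :=
  - weight n k (n + k) (n + k).+1 * (b / a *
  (th (c / b * q ^+ k) * th (a * x * q ^+ k) * th (a / x * q ^+ k) *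
   th (b * c * (q ^+ k * q ^+ n * q ^+ n)) * q ^+ n)).

Definition visit n k : F :=
  weight n k (n + k) (n + k) * (q ^+ k * th (b * q ^+ n / (a * q ^+ k))).

Lemma fac_cat z m k : fac z (m + k) = fac z m * fac (z * q ^+ m) k.
Proof.
rewrite /fac big_split_ord /=; congr (_ * _).
by apply: eq_bigr => l _; rewrite exprD mulrA.
Qed.

Lemma ifac_cat z m k : ifac z (m + k) = ifac z m * ifac (z * q ^+ m) k.
Proof.
rewrite /ifac big_split_ord /=; congr (_ * _).
by apply: eq_bigr => l _; rewrite exprD mulrA.
Qed.

Lemma facV z k : (fac z k)^-1 = ifac z k.
Proof. by rewrite /fac /ifac prodfV. Qed.

Lemma ifac_recl z k : ifac z k.+1 = (th z)^-1 * ifac (z * q) k.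
Proof.
rewrite /ifac big_ord_recl expr0 mulr1; congr (_ * _).
by apply: eq_bigr => l _; rewrite lift0 exprS mulrA.
Qed.

(** Splitting the factorials of length n + k at n produces (q)_n and (bc)_n, which cancel against
    the denominator of [weight]; th (a c q^n) cancels with the last factor of (ac)_(n+1). The three
    hypotheses license exactly these cancellations. *)
Lemma exit_right_factored n k :
  th (a * c * q ^+ n) != 0 -> fac (b * c) n != 0 -> fac q n != 0 ->
  fac (a * c) n.+1 * (fac (c / a) n.+1 * (fac (b * x) n.+1 * fac (b / x) n.+1)) /
  (fac (a * b) n.+1 * (fac (b / a) n.+1 * (fac (c * x) n.+1 * fac (c / x) n.+1))) *
  (th (a * c * q ^+ (n + 2 * k)) *
   (fac (a * c * q ^+ n) k * (fac (b * c * q ^+ n) k * (fac (c / b) k *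
   (fac (q ^+ n.+1) k * (fac (a * x) k * fac (a / x) k))))) /
   (th (a * c * q ^+ n) * (fac q k * (fac (a * q / b) k *
   (fac (a * b * q ^+ (1 + n)) k * (fac (a * c) k *
   (fac (c * q ^+ n.+1 / x) k * fac (c * x * q ^+ n.+1) k)))))) * q ^+ k) =
  exit_right n k.
Proof.
move=> h1 h2 h3; rewrite /exit_right /weight !invfM !facV -addSn add1n.
rewrite !(ifac_cat _ n.+1) !fac_cat (ifac_recl (b / a)) !(facS _ n).
rewrite (mulrAC b a^-1) (mulrAC c x^-1) -(exprS q n).
have -> : q ^+ n * q ^+ k * q ^+ k = q ^+ (n + 2 * k).
  by rewrite mul2n -addnn !exprD mulrA.
rewrite -(facV q n) -(facV (b * c) n).
move: (fac q n) (fac (b * c) n) (th (a * c * q ^+ n)) h1 h2 h3.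
move=> t1 t2 t3 h1 h2 h3.
move: (th (b / a))^-1 => t4.
by field; rewrite h1 h2 h3.
Qed.

Variables N M : nat.
(** Nonvanishing is assumed only in the ranges that regularity supplies, so the induction stays
    inside a fixed rectangle N x M. *)
Hypothesis ab_neq0 : forall l, (l <= N + M)%N -> th (a * b * q ^+ l) != 0.
Hypothesis cx_neq0 : forall l, (l <= N + M)%N -> th (c * x * q ^+ l) != 0.
Hypothesis cVx_neq0 : forall l, (l <= N + M)%N -> th (c / x * q ^+ l) != 0.
Hypothesis qN_neq0 : forall l, (l < N)%N -> th (q * q ^+ l) != 0.
Hypothesis qM_neq0 : forall l, (l < M)%N -> th (q * q ^+ l) != 0.
Hypothesis bc_neq0 : forall l, (l < N)%N -> th (b * c * q ^+ l) != 0.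
Hypothesis ac_neq0 : forall l, (l < M)%N -> th (a * c * q ^+ l) != 0.
Hypothesis bVa_neq0 : forall l, (l < N)%N -> th (b * q / a * q ^+ l) != 0.
Hypothesis aVb_neq0 : forall l, (l < M)%N -> th (a * q / b * q ^+ l) != 0.
Hypothesis ba_neq0 : th (b / a) != 0.

Let qX n : q ^+ n != 0. Proof. exact: expf_neq0. Qed.

Lemma exit_visit n k : (n <= N)%N -> (k <= M)%N ->
  exit_right n k + exit_up n k = visit n k.
Proof.
move=> nN kM; have nkM : (n + k <= N + M)%N by exact: leq_add.
have h1 := ab_neq0 nkM; have h2 := cx_neq0 nkM; have h3 := cVx_neq0 nkM.
rewrite /exit_right /exit_up mulNr -mulrBr three_term_sum //.
rewrite /visit /weight -exprD !(ifacS _ (n + k)).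
move: (th (a * b * _)) (th (c * x * _)) (th (c / x * _)) h1 h2 h3 => t1 t2 t3 h1 h2 h3.
by field; rewrite h1 h2 h3 ba_neq0.
Qed.

(** The exit is rewritten over the weight at the point where it arrives. With [exit_upE], the two
    ways of reaching a point then have a common weight. *)
Lemma exit_rightE n k : (n < N)%N ->
  exit_right n k = weight n.+1 k (n + k) (n + k).+1 *
    (th (q ^+ n.+1) * th (b * c * (q ^+ n.+1 / q)) * th (b / a * q ^+ n.+1) *
     th (a * c * (q ^+ n.+1 / q * q ^+ k * q ^+ k)) * q ^+ k).
Proof.
move=> nN; have h1 := qN_neq0 nN; have h2 := bc_neq0 nN; have h3 := bVa_neq0 nN.
rewrite /exit_right /weight !facS !(ifacS _ n) !exprS (mulrC q (q ^+ n)) mulfK //.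
have -> : q ^+ n * q = q * q ^+ n by rewrite mulrC.
have -> : b / a * (q * q ^+ n) = b * q / a * q ^+ n by ring.
move: (th (q * _)) (th (b * c * _)) (th (b * q / a * _)) h1 h2 h3 => t1 t2 t3 h1 h2 h3.
by field; rewrite h1 h2 h3 ba_neq0.
Qed.

Lemma exit_upE n k : (k < M)%N ->
  exit_up n k = - weight n k.+1 (n + k) (n + k).+1 * (b / a *
    (th (q ^+ k.+1) * th (a * c * (q ^+ k.+1 / q)) * th (a / b * q ^+ k.+1) *
     th (b * c * (q ^+ k.+1 / q * q ^+ n * q ^+ n)) * q ^+ n)).
Proof.
move=> kM; have h1 := qM_neq0 kM; have h2 := ac_neq0 kM; have h3 := aVb_neq0 kM.
rewrite /exit_up /weight !facS !(ifacS _ k) !exprS (mulrC q (q ^+ k)) mulfK //.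
have -> : q ^+ k * q = q * q ^+ k by rewrite mulrC.
have -> : a / b * (q * q ^+ k) = a * q / b * q ^+ k by ring.
move: (th (q * _)) (th (a * c * _)) (th (a * q / b * _)) h1 h2 h3 => t1 t2 t3 h1 h2 h3.
by field; rewrite h1 h2 h3 ba_neq0 a0.
Qed.

Lemma weight_step n k i j : weight n k i.+1 j =
  weight n k i j * (th (q ^+ i.+1) * th (a * c * (q ^+ i.+1 / q)) *
                    th (b * c * (q ^+ i.+1 / q))).
Proof.
rewrite /weight !(facS _ i) exprS (mulrC q (q ^+ i)) mulfK //.
by ring.
Qed.

Lemma visit_step n k : (n < N)%N -> (k < M)%N ->
  visit n.+1 k.+1 = exit_right n k.+1 + exit_up n.+1 k.
Proof.
move=> nN kM; rewrite exit_rightE // exit_upE // addnS addSn mulNr -mulrBr.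
rewrite three_term_step // /visit addnS addSn weight_step -exprD addSn addnS.
by rewrite -mulrA; congr (_ * _); rewrite !mulrA.
Qed.

(** On the bottom row K = 1, and th 1 = 0 removes the arrival from below. *)
Lemma visit_bottom n : (n < N)%N -> visit n.+1 0 = exit_right n 0.
Proof.
move=> nN; rewrite exit_rightE // addn0.
have h := three_term_step (qX n.+1) (qX 0).
rewrite {2}expr0 th1 !mul0r mulr0 subr0 in h.
rewrite h // /visit addn0 weight_step -exprD addn0.
by rewrite -mulrA; congr (_ * _); rewrite !mulrA.
Qed.

Lemma visit_left k : (k < M)%N -> visit 0 k.+1 = exit_up 0 k.
Proof.
move=> kM; rewrite exit_upE // add0n.
have h := three_term_step (qX 0) (qX k.+1).
rewrite {1}expr0 th1 !mul0r sub0r in h.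
rewrite mulNr -mulrN h // /visit add0n weight_step -exprD add0n.
by rewrite -mulrA; congr (_ * _); rewrite !mulrA.
Qed.

Lemma visit_origin : visit 0 0 = 1.
Proof.
rewrite /visit /weight /fac /ifac !big_ord0 !expr0 !mul1r !mulr1.
by rewrite mulVf.
Qed.

(** Conservation of flow: whatever enters column n + 1 from the left leaves it to the right or
    through the top. *)
Lemma exit_column n m : (n < N)%N -> (m <= M)%N ->
  \sum_(k < m.+1) exit_right n.+1 k + exit_up n.+1 m =
  \sum_(k < m.+1) exit_right n k.
Proof.
move=> nN; elim: m => [|m IH] mM.
  by rewrite !big_ord1 exit_visit // visit_bottom.
rewrite big_ord_recr /= -addrA exit_visit // visit_step //.
by rewrite [RHS]big_ord_recr /= -IH 1?ltnW // -addrA [X in _ = _ + X]addrC.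
Qed.

(** Induction on n absorbs the new upper exit by [exit_column]; the column n = 0 is treated by the
    same balance in m, starting from the unit mass at the origin. *)
Lemma exit_total n m : (n <= N)%N -> (m <= M)%N ->
  \sum_(k < m.+1) exit_right n k + \sum_(k < n.+1) exit_up k m = 1.
Proof.
elim: n => [_|n IH nN] mM.
  elim: m mM => [|m IHm] mM.
    by rewrite !big_ord1 exit_visit // visit_origin.
  rewrite !big_ord1 big_ord_recr /= -addrA exit_visit // visit_left //.
  by have := IHm (ltnW mM); rewrite big_ord1.
rewrite [X in _ + X]big_ord_recr /= addrA addrAC exit_column //.
exact: IH (ltnW nN) mM.
Qed.

End Telescoping.

Lemma exit_swap (F : fieldType) (th : F -> F) (q a b c x : F) n k :
  (forall y, y != 0 -> th y^-1 = - y^-1 * th y) -> a != 0 -> b != 0 ->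
  exit_right th q b a c x k n = exit_up th q a b c x n k.
Proof.
move=> thV a0 b0; rewrite /exit_right /exit_up /weight (addnC k n).
have ba0 : b / a != 0 by nonzero.
have e : (th (a / b))^-1 = - (b / a) / th (b / a).
  by rewrite -invf_div thV // invfM invrN invrK.
rewrite e (mulrC b a); move: (th (b / a))^-1 => t.
by ring.
Qed.

(** * Theta function and the identity at regular points *)

Section ThetaFunction.
Variable R : realType.
Local Notation C := R[i].
Variable p : C.
Hypothesis p_neq0 : p != 0.
Hypothesis p_lt1 : normc p < 1.
Implicit Types (x y z : C).

Lemma thetaE x : theta x p = (1 - x) * qpoch_inf (x * p) p * qpoch_inf (p / x) p.
Proof. by rewrite /theta (qpoch_inf_shift p_lt1 x). Qed.

Lemma theta1 : theta 1 p = 0.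
Proof. by rewrite thetaE subrr !mul0r. Qed.

Lemma theta_mulp x : x != 0 -> theta (x * p) p = - x^-1 * theta x p.
Proof.
move=> x0; rewrite [theta x p]thetaE /theta.
have -> : p / (x * p) = x^-1 by field; rewrite x0 p_neq0.
rewrite (qpoch_inf_shift p_lt1 x^-1) (mulrC x^-1 p).
move: (qpoch_inf (p / x) p) (qpoch_inf (x * p) p) => u v.
by field.
Qed.

Lemma thetaV x : x != 0 -> theta x^-1 p = - x^-1 * theta x p.
Proof.
move=> x0; rewrite -theta_mulp // /theta invrK mulrC (mulrC p x).
by congr (_ * qpoch_inf _ p); field; rewrite x0 p_neq0.
Qed.

Lemma theta_divp x : x != 0 -> theta (x / p) p = - (x / p) * theta x p.
Proof.
move=> x0; have xp0 : x / p != 0 by nonzero.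
have := theta_mulp xp0; rewrite divfK // => ->.
by rewrite mulrA mulrNN divff // mul1r.
Qed.

Lemma theta_eq0 x : x != 0 -> theta x p = 0 -> exists l : int, x = p ^ l.
Proof.
move=> x0 /eqP; rewrite mulf_eq0 => /orP[] /eqP /(qpoch_inf_eq0 p_lt1)[l h].
  exists (- l%:Z); rewrite -exprz_inv.
  by apply: (mulIf (expf_neq0 l p_neq0)); rewrite h -exprMn mulVf // expr1n.
exists l.+1%:Z; rewrite -[p ^ _]/(p ^+ l.+1).
by apply: (mulIf (invr_neq0 x0)); rewrite divff // -h exprS; ring.
Qed.

(** The symmetric relation at X, X / al, X / ga, X / be with X^2 = z: products and quotients of
    these points no longer involve the root. *)
Lemma theta_three_term_product z al be ga :
  z != 0 -> al != 0 -> be != 0 -> ga != 0 ->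
  theta (z / al) p * theta al p * (theta (z / (be * ga)) p * theta (be / ga) p) -
  theta (z / be) p * theta be p * (theta (z / (al * ga)) p * theta (al / ga) p) =
  al / ga * (theta (z / (al * be)) p * theta (be / al) p *
             (theta (z / ga) p * theta ga p)).
Proof.
move=> z0 al0 be0 ga0.
pose X := sqrtC z; have XE : X * X = z by rewrite -expr2 sqrtCK.
have X0 : X != 0 by rewrite sqrtC_eq0.
have := @theta_three_term _ p p_neq0 p_lt1 X (X / al) (X / ga) (X / be) X0
  ltac:(nonzero) ltac:(nonzero) ltac:(nonzero).
rewrite -XE.
have e u v : u != 0 -> v != 0 -> X / u * (X / v) = X * X / (u * v).
  by move=> *; field; do ?[apply/andP; split]; nonzero.
have e' u v : u != 0 -> v != 0 -> X / u / (X / v) = v / u.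
  by move=> *; field; do ?[apply/andP; split]; nonzero.
have e1 u : u != 0 -> X / (X / u) = u.
  by move=> *; field; do ?[apply/andP; split]; nonzero.
by rewrite !e // !e' // !e1 // !(mulrA X X) (mulrC ga be) (mulrC ga al).
Qed.

End ThetaFunction.

(** * The identity at regular points *)

Section Identity.
Variable R : realType.
Local Notation C := R[i].
Variables q p : C.
Hypothesis q_neq0 : q != 0.
Hypothesis p_neq0 : p != 0.
Hypothesis p_lt1 : normc p < 1.
Local Notation th := (fun y : C => theta y p).

Lemma theta_fact1E y k : theta_fact1 y q p k = fac th q y k.
Proof. by []. Qed.

Lemma fac_neq0 y k l : fac th q y k != 0 -> (l < k)%N -> theta (y * q ^+ l) p != 0.
Proof. by move=> /prodf_neq0 h lk; exact: (h (Ordinal lk)). Qed.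

Lemma summandE n m a b c x : a != 0 -> b != 0 ->
  regular_point q p n m a b c x -> fac th q (b * c) n != 0 -> fac th q q n != 0 ->
  summand q p n m a b c x = \sum_(k < m.+1) exit_right th q a b c x n k.
Proof.
move=> a0 b0 [_ hden] bc0 qn0.
have acn0 : theta (a * c * q ^+ n) p != 0.
  by have := hden 0%N isT; rewrite /term_den mulf_eq0 negb_or => /andP[].
rewrite /summand big_mkord mulr_sumr; apply: eq_bigr => k _.
rewrite /prefactor_num /prefactor_den /term_num /term_den /theta_fact.
by rewrite !big_cons !big_nil !mulr1 !theta_fact1E; exact: exit_right_factored.
Qed.

(** The denominator with k = m suffices, as its factorials are the longest. Those starting at
    q^(n+1) continue the ones of length n + 1 in the prefactor, which gives length n + m + 1. *)
Lemma regular_fac n m a b c x : regular_point q p n m a b c x ->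
  [/\ [/\ fac th q (a * b) (n + m).+1 != 0, fac th q (c * x) (n + m).+1 != 0 &
       fac th q (c / x) (n + m).+1 != 0],
      fac th q (b / a) n.+1 != 0, fac th q (a * q / b) m != 0,
      fac th q q m != 0 & fac th q (a * c) m != 0].
Proof.
move=> [hpre /(_ m (leqnn m))].
rewrite /term_den /theta_fact !big_cons big_nil mulr1 !theta_fact1E !mulf_eq0 !negb_or.
move=> /andP[_ /and3P[qm aqb]] /and4P[abm ac cxm' cxm].
move: hpre; rewrite /prefactor_den /theta_fact !big_cons big_nil mulr1.
rewrite !theta_fact1E !mulf_eq0 !negb_or => /and4P[abn ban cxn cxn'].
rewrite add1n in abm; rewrite (mulrAC c _ x^-1) in cxm'.
have cat (z : C) : fac th q z n.+1 != 0 -> fac th q (z * q ^+ n.+1) m != 0 ->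
    fac th q z (n + m).+1 != 0.
  by move=> h1 h2; rewrite -addSn fac_cat; exact: mulf_neq0.
exact: (And5 (And3 (cat _ abn abm) (cat _ cxn cxm) (cat _ cxn' cxm')) ban aqb qm ac).
Qed.

Lemma identity_at_regular_point n m a b c x :
  a != 0 -> b != 0 -> c != 0 -> x != 0 ->
  regular_point q p n m a b c x -> regular_point q p m n b a c x ->
  1 = summand q p n m a b c x + summand q p m n b a c x.
Proof.
move=> a0 b0 c0 x0 r1 r2.
have [[ab cx cVx] ba aqb qm ac] := regular_fac r1.
have [_ _ bqa qn bc] := regular_fac r2.
rewrite !summandE //; try assumption.
have swap : \sum_(k < n.+1) exit_right th q b a c x m k =
    \sum_(k < n.+1) exit_up th q a b c x k m.
  by apply: eq_bigr => k _; exact: exit_swap (@thetaV _ p p_neq0 p_lt1) a0 b0.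
have aux z k : fac th q z k != 0 -> forall l, (l < k)%N -> theta (z * q ^+ l) p != 0.
  by move=> h l; exact: fac_neq0.
rewrite swap; apply/esym.
apply: (exit_total (theta1 p_lt1) (@thetaV _ p p_neq0 p_lt1)
  (@theta_three_term_product _ p p_neq0 p_lt1) q_neq0 a0 b0 c0 x0
  (aux _ _ ab) (aux _ _ cx) (aux _ _ cVx) (aux _ _ qn) (aux _ _ qm)
  (aux _ _ bc) (aux _ _ ac) (aux _ _ bqa) (aux _ _ aqb)) => //.
by have := aux _ _ ba 0%N isT; rewrite expr0 mulr1.
Qed.

End Identity.

(** * Complex exponential *)

Section ComplexExponential.
Variable R : realType.
Local Notation C := R[i].
Implicit Types (z w h : C).

Lemma cexpD z w : cexp (z + w) = cexp z * cexp w.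
Proof.
case: z w => [a b] [c d]; rewrite /cexp /= expRD cosD sinD.
by apply/eqP; rewrite eq_complex /=; apply/andP; split; apply/eqP; ring.
Qed.

Lemma cexp0 : cexp (0 : C) = 1.
Proof. by rewrite /cexp /= expR0 cos0 sin0 !mul1r. Qed.

Lemma cexp_neq0 z : cexp z != 0.
Proof.
apply/negP => /eqP h; have := cexpD z (- z); rewrite subrr cexp0 h mul0r.
by move/eqP; rewrite oner_eq0.
Qed.

Lemma cexpN z : cexp (- z) = (cexp z)^-1.
Proof.
by apply: (mulfI (cexp_neq0 z)); rewrite -cexpD subrr cexp0 divff ?cexp_neq0.
Qed.

Lemma cexp_2pi : cexp2pi (1 : C) = 1.
Proof.
rewrite /cexp2pi mulr1 /cexp /= expR0 !mul1r.
have -> : 2 * pi = pi *+ 2 :> R by rewrite mulr_natl.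
by rewrite cos2pi sin2pi.
Qed.

(** From exp x <= 1 / (1 - x) the error is at most x^2 / (1 - x), and 1 - x >= 1/2. *)
Lemma expR_taylor (x : R) : `|x| <= 1 / 2 -> `|expR x - 1 - x| <= 2 * x ^+ 2.
Proof.
move=> hx; have := hx; rewrite ler_norml => /andP[h1 h2].
have l := expR_ge1Dx x; have l' := expR_ge1Dx (- x).
have e : expR x * expR (- x) = 1 by rewrite expRN divff // gt_eqF ?expR_gt0.
have e0 := expR_gt0 x.
rewrite ger0_norm; last by lra.
have u : expR x * (1 - x) <= 1 by rewrite -e ler_wpM2l //; lra.
by rewrite expr2; nra.
Qed.

Lemma sin_norm_le (x : R) : `|sin x| <= `|x|.
Proof.
wlog x0 : x / 0 <= x => [hw|].
  have [/hw //|/ltW x0] := leP 0 x.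
  by rewrite -normrN -sinN -[`|x|]normrN; apply: hw; rewrite oppr_ge0.
have hd y : y \in `]0, x[ -> is_derive y 1 sin (cos y).
  by move=> _; exact: is_derive_sin.
have hc : {within `[0, x], continuous (@sin R)}.
  by apply: continuous_subspaceT => y; exact: continuous_sin.
have [c _] := MVT_segment x0 hd hc.
rewrite sin0 !subr0 => ->; rewrite normrM ler_piMl //.
exact: cos_max.
Qed.

Lemma cos_taylor (x : R) : `|cos x - 1| <= x ^+ 2.
Proof.
have -> : cos x - 1 = - (2 * sin (x / 2) ^+ 2).
  have e : x = x / 2 + x / 2 by lra.
  rewrite {1}e cosD; have := cos2Dsin2 (x / 2); rewrite !expr2; lra.
rewrite normrN normrM normrX ger0_norm //.
have := sin_norm_le (x / 2); rewrite normrM [`|2^-1|]ger0_norm ?invr_ge0 // => h.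
have h' := normr_ge0 (sin (x / 2)).
have e : x ^+ 2 = `|x| ^+ 2 by rewrite real_normK ?num_real.
by rewrite e !expr2; nra.
Qed.

Lemma sin_taylor (x : R) : `|x| <= 1 -> `|sin x - x| <= x ^+ 2.
Proof.
wlog x0 : x / 0 <= x => [hw|].
  have [/hw //|/ltW x0] := leP 0 x.
  move=> x1; have := hw (- x); rewrite oppr_ge0 normrN sinN sqrrN -opprD normrN.
  by apply.
move=> x1.
have hd y : y \in `]0, x[ -> is_derive y 1 (sin - id) ((cos - cst 1) y).
  by move=> _; exact: is_deriveB.
have hc : {within `[0, x], continuous (sin - id : R -> R)}.
  apply: continuous_subspaceT => y; apply: continuousB => //.
  exact: continuous_sin.
have [c] := MVT_segment x0 hd hc.
rewrite in_itv /= => /andP[c0 cx].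
rewrite !fctE sin0 !subr0 => ->; rewrite normrM expr2.
apply: ler_pM => //; last by rewrite ger0_norm.
apply: le_trans (cos_taylor c) _; rewrite expr2.
move: x1; rewrite ger0_norm // => x1; nra.
Qed.

(** The four error terms below contribute 2 + 2 + 1 + 2 = 7 times |h|^2; the constant 10 leaves
    slack. *)
Lemma cexp_taylor h : normc h <= 1 / 2 ->
  normc (cexp h - 1 - h) <= 10 * normc h ^+ 2.
Proof.
move=> hh; have hr := normr_Re_le h; have hi := normr_Im_le h.
case: h hh hr hi => a b; set r := normc (a +i* b) => hh hr hi.
rewrite /= in hr hi.
have ea := @expR_taylor a (le_trans hr hh).
have cb := cos_taylor b.
have sb : `|sin b - b| <= b ^+ 2 by apply: sin_taylor; lra.
have cm := cos_max b; have sm := sin_max b.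
have a2 : a ^+ 2 <= r ^+ 2.
  by rewrite -[a ^+ 2]real_normK ?num_real // !expr2 ler_pM.
have b2 : b ^+ 2 <= r ^+ 2.
  by rewrite -[b ^+ 2]real_normK ?num_real // !expr2 ler_pM.
apply: le_trans (normc_le_ReIm _) _; rewrite /=.
have eb : `|expR a| <= 2.
  by have := normr_ge0 a; move: ea; rewrite !ler_norml expr2 => /andP[]; rewrite ler_norml in hr; nra.
have e1 : `|expR a - 1| <= 2 * r.
  have : `|a| <= 1 / 2 by lra.
  have -> : expR a - 1 = (expR a - 1 - a) + a by ring.
  move=> a1; apply: le_trans (ler_normD _ _) _.
  have : 2 * a ^+ 2 <= `|a|.
    by rewrite -[a ^+ 2]real_normK ?num_real // expr2; have := normr_ge0 a; nra.
  lra.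
have -> : expR a * cos b - 1 - a = (expR a - 1 - a) + expR a * (cos b - 1) by ring.
have -> : expR a * sin b - 0 - b = (sin b - b) + (expR a - 1) * sin b by ring.
have h1 : `|expR a * (cos b - 1)| <= 2 * r ^+ 2.
  by rewrite normrM ler_pM // (le_trans cb).
have h2 : `|(expR a - 1) * sin b| <= 2 * r * r.
  by rewrite normrM ler_pM // (le_trans (sin_norm_le b)).
have := ler_normD (expR a - 1 - a) (expR a * (cos b - 1)).
have := ler_normD (sin b - b) ((expR a - 1) * sin b).
have r2 := sqr_ge0 r.
rewrite !expr2 in a2 b2 h1 ea sb r2 *; lra.
Qed.

End ComplexExponential.

(** * Meromorphic functions *)

Section Meromorphic.
Variable R : realType.
Local Notation C := R[i].
Implicit Types (f g : C^o -> C^o) (z w h : C^o).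

Lemma near_normcP (z : C^o) (P : C^o -> Prop) :
  (\forall w \near z, P w) <->
  exists2 e : R, 0 < e & forall w, normc (w - z) < e -> P w.
Proof.
split.
  move=> /nbhs_ballP[e /= /lt0_real_complex[d d0 ->] h].
  exists d => // w wd; apply: h; rewrite /ball /= normr_normc ltcR.
  by rewrite normc_distC.
move=> [e e0 h]; apply/nbhs_ballP; exists e%:C; first by rewrite /= ltcR.
move=> w; rewrite /ball /= normr_normc ltcR => hw; apply: h.
by rewrite normc_distC.
Qed.

Lemma dnear_normcP (z : C^o) (P : C^o -> Prop) :
  (\forall w \near z^', P w) <->
  exists2 e : R, 0 < e & forall w, normc (w - z) < e -> w != z -> P w.
Proof.
rewrite /dnbhs; split.
  by move=> /near_normcP[e e0 h]; exists e => // w hw wz; apply: h.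
by move=> [e e0 h]; apply/near_normcP; exists e => // w hw wz; apply: h.
Qed.

Lemma taylor_derivable f z (d : C) (K e : R) : 0 < e ->
  (forall h, normc h <= e ->
     normc (f (z + h) - f z - h * d) <= K * normc h ^+ 2) ->
  derivable f z 1.
Proof.
move=> e0 hf; apply/cvg_ex; exists d; apply/cvgrPdist_le => eps.
move=> /lt0_real_complex[r r0 ->]; apply/dnear_normcP.
have K0 : 0 <= K.
  have := le_trans (normc_ge0 _) (hf (e%:C) _).
  rewrite normc_real ger0_norm ?(ltW e0) // => /(_ (lexx _)).
  by rewrite pmulr_lge0 // exprn_gt0.
exists (Num.min e (r / (K + 1))).
  by rewrite lt_min e0 divr_gt0 //; lra.
move=> h; rewrite subr0 lt_min => /andP[he hr] h0.
rewrite normr_normc lecR /= scaler1.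
have nh : 0 < normc h by rewrite normc_gt0.
have -> : d - h^-1 *: (f (h + z) - f z) = - h^-1 * (f (z + h) - f z - h * d).
  by rewrite /GRing.scale /= (addrC h z); field.
rewrite normcM normcNE normcV ler_pdivrMl //.
apply: le_trans (hf _ (ltW he)) _; rewrite expr2 mulrCA ler_wpM2l ?(ltW nh) //.
move: hr; rewrite ltr_pdivlMr; nra.
Qed.

Lemma holomorphic_near_all f z : (forall w, derivable f w 1) -> holomorphic_near f z.
Proof. by move=> h; near=> w; exact: h. Unshelve. all: by end_near. Qed.

Lemma holomorphic_nearM f g z : holomorphic_near f z -> holomorphic_near g z ->
  holomorphic_near (fun w => f w * g w) z.
Proof. by apply: filterS2 => w hf hg; exact: (derivableM hf hg). Qed.

Lemma holomorphic_nearD f g z : holomorphic_near f z -> holomorphic_near g z ->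
  holomorphic_near (fun w => f w + g w) z.
Proof. by apply: filterS2 => w hf hg; exact: (derivableD hf hg). Qed.

Lemma holomorphic_near_cst (c : C) z : holomorphic_near (fun=> c) z.
Proof. by apply: holomorphic_near_all => w; exact: derivable_cst. Qed.

Lemma derivable_subX (N : nat) z w : derivable (fun w : C^o => (w - z) ^+ N : C^o) w 1.
Proof.
elim: N => [|N IH]; first exact: derivable_cst.
have -> : (fun w : C^o => (w - z) ^+ N.+1 : C^o) =
  (fun w : C^o => (w - z : C^o) * ((w - z) ^+ N : C^o)).
  by apply/funext => v; rewrite exprS.
have d1 : derivable (id - cst z : C^o -> C^o) w 1.
  by apply: derivableB; [exact: derivable_id | exact: derivable_cst].
exact: (derivableM d1 IH).
Qed.

Lemma derivable_near_neq0 f z : derivable f z 1 -> f z != 0 ->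
  \forall w \near z, f w != 0.
Proof.
move=> dz fz.
exact: cvgr_neq0 (differentiable_continuous ((derivable1_diffP f z).1 dz)) fz.
Qed.

Lemma holomorphic_nearV f z : holomorphic_near f z -> f z != 0 ->
  holomorphic_near (fun w => (f w)^-1) z.
Proof.
move=> hf fz; have fn := derivable_near_neq0 (nbhs_singleton hf) fz.
rewrite /holomorphic_near; near=> w.
have fw : f w != 0 by near: w.
have hw : derivable f w 1 by near: w.
exact: (derivableV fw hw).
Unshelve. all: by end_near. Qed.

Definition meromorphic_at (f : C -> C) (z : C^o) : Prop :=
  exists (N : nat) (g : C^o -> C^o),
    holomorphic_near g z /\ \forall w \near z^', (w - z) ^+ N * f w = g w.

Lemma meromorphic_holomorphic f z : holomorphic_near f z -> meromorphic_at f z.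
Proof.
move=> hf; exists 0%N, f; split => //.
by apply: nearW => w; rewrite expr0 mul1r.
Qed.

Lemma meromorphic_atM (f g : C -> C) z : meromorphic_at f z ->
  meromorphic_at g z -> meromorphic_at (fun w => f w * g w) z.
Proof.
move=> [N [f' [hf ef]]] [M [g' [hg eg]]]; exists (N + M)%N, (fun w => f' w * g' w).
split; first exact: holomorphic_nearM.
near=> w; rewrite exprD mulrACA.
by congr (_ * _); near: w.
Unshelve. all: by end_near. Qed.

Lemma meromorphic_atD (f g : C -> C) z : meromorphic_at f z ->
  meromorphic_at g z -> meromorphic_at (fun w => f w + g w) z.
Proof.
move=> [N [f' [hf ef]]] [M [g' [hg eg]]].
exists (N + M)%N, (fun w => (w - z) ^+ M * f' w + (w - z) ^+ N * g' w).
split.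
  have hX n := @holomorphic_near_all _ z (@derivable_subX n z).
  exact: holomorphic_nearD (holomorphic_nearM (hX M) hf) (holomorphic_nearM (hX N) hg).
near=> w.
have <- : (w - z) ^+ N * f w = f' w by near: w.
have <- : (w - z) ^+ M * g w = g' w by near: w.
by rewrite exprD; ring.
Unshelve. all: by end_near. Qed.

Lemma meromorphic_at_cst (c : C) z : meromorphic_at (fun=> c) z.
Proof. by apply: meromorphic_holomorphic; exact: holomorphic_near_cst. Qed.

Lemma meromorphic_at_prod I (r : seq I) (F : I -> C -> C) z :
  (forall i, meromorphic_at (F i) z) ->
  meromorphic_at (fun w => \prod_(i <- r) F i w) z.
Proof.
move=> h; elim: r => [|i r IH].
  by under eq_fun do rewrite big_nil; exact: meromorphic_at_cst.
by under eq_fun do rewrite big_cons; exact: meromorphic_atM.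
Qed.

Lemma meromorphic_at_sum I (r : seq I) (F : I -> C -> C) z :
  (forall i, meromorphic_at (F i) z) ->
  meromorphic_at (fun w => \sum_(i <- r) F i w) z.
Proof.
move=> h; elim: r => [|i r IH].
  by under eq_fun do rewrite big_nil; exact: meromorphic_at_cst.
by under eq_fun do rewrite big_cons; exact: meromorphic_atD.
Qed.

Lemma derivable_cexp_affine (al be : C) z :
  derivable (fun w : C^o => cexp (al * w + be) : C^o) z 1.
Proof.
pose e := (2 * (normc al + 1))^-1.
have e0 : 0 < e by rewrite invr_gt0; have := normc_ge0 al; lra.
pose K := normc (cexp (al * z + be)) * (10 * normc al ^+ 2).
apply: (@taylor_derivable _ _ (al * cexp (al * z + be)) K e e0) => h he.
have -> : al * (z + h) + be = (al * z + be) + al * h by ring.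
rewrite cexpD.
have -> : cexp (al * z + be) * cexp (al * h) - cexp (al * z + be) -
   h * (al * cexp (al * z + be)) = cexp (al * z + be) * (cexp (al * h) - 1 - al * h).
  by ring.
rewrite normcM -mulrA ler_wpM2l ?normc_ge0 // -mulrA -exprMn -normcM.
apply: cexp_taylor; rewrite normcM.
apply: le_trans (_ : normc al * e <= _); first by rewrite ler_wpM2l ?normc_ge0.
rewrite /e ler_pdivrMr; have := normc_ge0 al; lra.
Qed.

(* The pole is simple, but clearing it by the square of the variable makes
   differentiability at the zero of the denominator a first-order estimate. *)
Lemma meromorphic_atV_cexp (al : C) z : al != 0 ->
  meromorphic_at (fun w => (1 - cexp (al * (w - z)))^-1) z.
Proof.
move=> al0; pose E (w : C) : C := 1 - cexp (al * (w - z)).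
have nal : 0 < normc al by rewrite normc_gt0.
have dE w : derivable (E : C^o -> C^o) w 1.
  have -> : E = cst 1 - (fun w : C^o => cexp (al * w + - (al * z)) : C^o).
    by apply/funext => v; rewrite /E !fctE mulrBr.
  by apply: derivableB; [exact: derivable_cst | exact: derivable_cexp_affine].
(* On this radius |al h| <= 1/20, so the Taylor error 10 |al h|^2 is at most |al h| / 2 and z is the
   only zero of E. *)
pose e := (20 * normc al)^-1.
have e0 : 0 < e by rewrite invr_gt0; lra.
have ale h : normc h <= e -> normc (al * h) <= 1 / 20.
  by rewrite /e -[_^-1]mul1r ler_pdivlMr ?normcM; lra.
have Ebnd h : normc h <= e ->
  normc (E (z + h) + al * h) <= 10 * (normc (al * h) ^+ 2) /\
  normc (al * h) / 2 <= normc (E (z + h)).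
  move=> he; have ah := ale _ he.
  have t : normc (E (z + h) + al * h) <= 10 * (normc (al * h) ^+ 2).
    rewrite /E (addrC z h) addrK.
    have -> : 1 - cexp (al * h) + al * h = - (cexp (al * h) - 1 - al * h) by ring.
    by rewrite normcNE; apply: cexp_taylor; lra.
  split => //.
  have := normc_ler_sub (al * h) (- E (z + h)).
  rewrite normcNE opprK (addrC (al * h)); have := normc_ge0 (al * h).
  move: t; rewrite expr2; nra.
have E0 h : h != 0 -> normc h <= e -> E (z + h) != 0.
  move=> h0 he; have [_] := Ebnd _ he; rewrite -normc_gt0; apply: lt_le_trans.
  by rewrite divr_gt0 // normc_gt0 mulf_neq0.
exists 2%N, (fun w => (w - z) ^+ 2 * (E w)^-1); split; last by apply: nearW.
apply/near_normcP; exists e => // w hw.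
have [->|wz] := eqVneq w z; last first.
  suff EV : derivable (fun v : C^o => (E v)^-1 : C^o) w 1.
    exact: (derivableM (@derivable_subX 2 z w) EV).
  apply: (derivableV _ (dE w)); have := E0 (w - z); rewrite subrKC subr_eq0.
  by apply => //; exact: ltW.
(* Since E (z + h) = - al h + O(h^2), the function h^2 / E (z + h) has slope - 1 / al at 0, its
   value there being 0 by convention. The constant 20 is 10 divided by the 1/2 of the lower
   bound. *)
apply: (@taylor_derivable _ _ (- al^-1) 20 e e0) => h he.
have [->|h0] := eqVneq h 0.
  by rewrite addr0 subrr mul0r subr0 normc0 expr2 mul0r mulr0.
have [t1 t2] := Ebnd _ he; have nE := E0 _ h0 he.
have nh : 0 < normc h by rewrite normc_gt0.
rewrite subrr expr0n /= mul0r subr0 (addrC z h) addrK (addrC h z).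
have -> : h ^+ 2 / E (z + h) - h * - al^-1 =
  h * (E (z + h) + al * h) / (al * E (z + h)).
  by field; rewrite al0 nE.
rewrite normcM normcV !normcM ler_pdivrMr; last first.
  by rewrite mulr_gt0 // normc_gt0.
rewrite !normcM in t1 t2.
apply: le_trans (_ : normc h * (10 * (normc al * normc h) ^+ 2) <= _).
  by rewrite ler_wpM2l ?normc_ge0.
have -> : normc h * (10 * (normc al * normc h) ^+ 2) =
  20 * normc h ^+ 2 * (normc al * (normc al * normc h / 2)) by field.
apply: ler_wpM2l; first by rewrite mulr_ge0 ?sqr_ge0.
by apply: ler_wpM2l t2; exact: ltW.
Qed.

End Meromorphic.

(** * Quasi-periodicity *)

Section QuasiPeriodicity.
Variable F : fieldType.
Variables (th : F -> F) (p q : F).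
Hypothesis p0 : p != 0.
Hypothesis q0 : q != 0.
Hypothesis thM : forall x, x != 0 -> th (x * p) = - x^-1 * th x.
Hypothesis thD : forall x, x != 0 -> th (x / p) = - (x / p) * th x.
Implicit Types (a b c x y z : F).

Definition mulp_factor z k : F := \prod_(l < k) - (z * q ^+ l)^-1.
Definition divp_factor z k : F := \prod_(l < k) - (z * q ^+ l / p).

Let qX n : q ^+ n != 0. Proof. exact: expf_neq0. Qed.

Lemma mulp_factor_neq0 z k : z != 0 -> mulp_factor z k != 0.
Proof.
move=> z0; apply/prodf_neq0 => l _; rewrite oppr_eq0; apply: invr_neq0.
exact: mulf_neq0.
Qed.

Lemma divp_factor_neq0 z k : z != 0 -> divp_factor z k != 0.
Proof.
by move=> z0; apply/prodf_neq0 => l _; rewrite oppr_eq0; nonzero.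
Qed.

(** The argument is an equation y = z p so that p may sit anywhere inside y, as in b * (x * p). *)
Lemma fac_mulp y z k : y = z * p -> z != 0 ->
  fac th q y k = mulp_factor z k * fac th q z k.
Proof.
move=> -> z0; rewrite /fac /mulp_factor -big_split; apply: eq_bigr => l _ /=.
by rewrite mulrAC thM //; exact: mulf_neq0.
Qed.

Lemma fac_divp y z k : y = z / p -> z != 0 ->
  fac th q y k = divp_factor z k * fac th q z k.
Proof.
move=> -> z0; rewrite /fac /divp_factor -big_split; apply: eq_bigr => l _ /=.
by rewrite mulrAC thD //; exact: mulf_neq0.
Qed.

Lemma th_mulp y z : y = z * p -> z != 0 -> th y = - z^-1 * th z.
Proof. by move=> ->; exact: thM. Qed.

(** This holds for v = 0 too, so periodicity extends to points where a denominator vanishes. *)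
Lemma ratio_scale (m u v u' v' : F) : m != 0 -> u' = m * u -> v' = m * v ->
  u' / v' = u / v.
Proof. by move=> m0 -> ->; rewrite -mulf_div divff // mul1r. Qed.

Definition pre_num n a b c x :=
  fac th q (a * c) n * (fac th q (c / a) n *
  (fac th q (b * x) n * fac th q (b / x) n)).
Definition pre_den n a b c x :=
  fac th q (a * b) n * (fac th q (b / a) n *
  (fac th q (c * x) n * fac th q (c / x) n)).
Definition trm_num n a b c x k :=
  th (a * c * q ^+ (n + 2 * k)) *
   (fac th q (a * c * q ^+ n) k * (fac th q (b * c * q ^+ n) k *
   (fac th q (c / b) k * (fac th q (q ^+ n.+1) k *
   (fac th q (a * x) k * fac th q (a / x) k))))).
Definition trm_den n a b c x k :=
  th (a * c * q ^+ n) * (fac th q q k * (fac th q (a * q / b) k *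
   (fac th q (a * b * q ^+ (1 + n)) k * (fac th q (a * c) k *
   (fac th q (c * q ^+ n.+1 / x) k * fac th q (c * x * q ^+ n.+1) k))))).

Definition ratio_sum n m a b c x :=
  pre_num n.+1 a b c x / pre_den n.+1 a b c x *
  \sum_(0 <= k < m.+1) trm_num n a b c x k / trm_den n a b c x k * q ^+ k.

Variables a b c x : F.
Hypotheses (a0 : a != 0) (b0 : b != 0) (c0 : c != 0) (x0 : x != 0).

Ltac arg := by field; do ?[apply/andP; split]; nonzero.
Ltac factor := rewrite /mulp_factor /divp_factor -?big_split; apply: eq_bigr => l _ /=;
  by field; do ?[apply/andP; split]; nonzero.

(** Each of the k paired factors equals 1 / (x^2 p), whatever u is. *)
Lemma pair_x u v k : u != 0 -> v != 0 ->
  mulp_factor (u * x) k * divp_factor (u / x) k =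
  mulp_factor (v * x) k * divp_factor (v / x) k.
Proof. by move=> u0 v0; factor. Qed.

Lemma pre_x n : pre_num n a b c (x * p) / pre_den n a b c (x * p) =
  pre_num n a b c x / pre_den n a b c x.
Proof.
apply: (@ratio_scale (mulp_factor (b * x) n * divp_factor (b / x) n)).
- by apply: mulf_neq0; [apply: mulp_factor_neq0 | apply: divp_factor_neq0]; nonzero.
- rewrite /pre_num (@fac_mulp (b * (x * p)) (b * x)) ?(@fac_divp (b / (x * p)) (b / x));
    [ring | arg | by nonzero | arg | by nonzero].
- rewrite (pair_x _ b0 c0).
  rewrite /pre_den (@fac_mulp (c * (x * p)) (c * x)) ?(@fac_divp (c / (x * p)) (c / x));
    [ring | arg | by nonzero | arg | by nonzero].
Qed.

Lemma pre_a n : pre_num n (a * p) b c x / pre_den n (a * p) b c x =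
  pre_num n a b c x / pre_den n a b c x.
Proof.
apply: (@ratio_scale (mulp_factor (a * c) n * divp_factor (c / a) n)).
- by apply: mulf_neq0; [apply: mulp_factor_neq0 | apply: divp_factor_neq0]; nonzero.
- rewrite /pre_num (@fac_mulp (a * p * c) (a * c)) ?(@fac_divp (c / (a * p)) (c / a));
    [ring | arg | by nonzero | arg | by nonzero].
- have -> : mulp_factor (a * c) n * divp_factor (c / a) n =
    mulp_factor (a * b) n * divp_factor (b / a) n by factor.
  rewrite /pre_den (@fac_mulp (a * p * b) (a * b)) ?(@fac_divp (b / (a * p)) (b / a));
    [ring | arg | by nonzero | arg | by nonzero].
Qed.

Lemma pre_b n : pre_num n a (b * p) c x / pre_den n a (b * p) c x =
  pre_num n a b c x / pre_den n a b c x.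
Proof.
apply: (@ratio_scale (mulp_factor (b * x) n * mulp_factor (b / x) n)).
- by apply: mulf_neq0; apply: mulp_factor_neq0; nonzero.
- rewrite /pre_num (@fac_mulp (b * p * x) (b * x)) ?(@fac_mulp (b * p / x) (b / x));
    [ring | arg | by nonzero | arg | by nonzero].
- have -> : mulp_factor (b * x) n * mulp_factor (b / x) n =
    mulp_factor (a * b) n * mulp_factor (b / a) n by factor.
  rewrite /pre_den (@fac_mulp (a * (b * p)) (a * b)) ?(@fac_mulp (b * p / a) (b / a));
    [ring | arg | by nonzero | arg | by nonzero].
Qed.

Lemma pre_c n : pre_num n a b (c * p) x / pre_den n a b (c * p) x =
  pre_num n a b c x / pre_den n a b c x.
Proof.
apply: (@ratio_scale (mulp_factor (a * c) n * mulp_factor (c / a) n)).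
- by apply: mulf_neq0; apply: mulp_factor_neq0; nonzero.
- rewrite /pre_num (@fac_mulp (a * (c * p)) (a * c)) ?(@fac_mulp (c * p / a) (c / a));
    [ring | arg | by nonzero | arg | by nonzero].
- have -> : mulp_factor (a * c) n * mulp_factor (c / a) n =
    mulp_factor (c * x) n * mulp_factor (c / x) n by factor.
  rewrite /pre_den (@fac_mulp (c * p * x) (c * x)) ?(@fac_mulp (c * p / x) (c / x));
    [ring | arg | by nonzero | arg | by nonzero].
Qed.

Lemma trm_x n k : trm_num n a b c (x * p) k / trm_den n a b c (x * p) k =
  trm_num n a b c x k / trm_den n a b c x k.
Proof.
apply: (@ratio_scale (mulp_factor (a * x) k * divp_factor (a / x) k)).
- by apply: mulf_neq0; [apply: mulp_factor_neq0 | apply: divp_factor_neq0]; nonzero.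
- rewrite /trm_num (@fac_mulp (a * (x * p)) (a * x)) ?(@fac_divp (a / (x * p)) (a / x));
    [ring | arg | by nonzero | arg | by nonzero].
- have -> : mulp_factor (a * x) k * divp_factor (a / x) k =
    mulp_factor (c * x * q ^+ n.+1) k * divp_factor (c * q ^+ n.+1 / x) k.
    by have qn := qX n.+1; move: (q ^+ n.+1) qn => Q Q0; factor.
  rewrite /trm_den (@fac_mulp (c * (x * p) * q ^+ n.+1) (c * x * q ^+ n.+1))
     ?(@fac_divp (c * q ^+ n.+1 / (x * p)) (c * q ^+ n.+1 / x));
    [ring | arg | by nonzero | arg | by nonzero].
Qed.

Lemma trm_b n k : trm_num n a (b * p) c x k / trm_den n a (b * p) c x k =
  trm_num n a b c x k / trm_den n a b c x k.
Proof.
apply: (@ratio_scale (mulp_factor (b * c * q ^+ n) k * divp_factor (c / b) k)).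
- by apply: mulf_neq0; [apply: mulp_factor_neq0 | apply: divp_factor_neq0]; nonzero.
- rewrite /trm_num (@fac_mulp (b * p * c * q ^+ n) (b * c * q ^+ n))
    ?(@fac_divp (c / (b * p)) (c / b)); [ring | arg | by nonzero | arg | by nonzero].
- have -> : mulp_factor (b * c * q ^+ n) k * divp_factor (c / b) k =
    mulp_factor (a * b * q ^+ (1 + n)) k * divp_factor (a * q / b) k.
    by rewrite add1n exprS; have qn := qX n; move: (q ^+ n) qn => Q Q0; factor.
  rewrite /trm_den (@fac_mulp (a * (b * p) * q ^+ (1 + n)) (a * b * q ^+ (1 + n)))
     ?(@fac_divp (a * q / (b * p)) (a * q / b));
    [ring | arg | by nonzero | arg | by nonzero].
Qed.

(** The multipliers of theta(a c q^(n+2k)) and theta(a c q^n) differ by q^(-2k). Spread over the k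
    factors as q^2 each, the compensating power can be checked factor by factor. *)
Lemma expr_double_prod k : q ^+ (2 * k) = \prod_(l < k) (q ^+ 2).
Proof. by rewrite prodr_const card_ord exprM. Qed.

Lemma trm_a n k : trm_num n (a * p) b c x k / trm_den n (a * p) b c x k =
  trm_num n a b c x k / trm_den n a b c x k.
Proof.
apply: (@ratio_scale (- (a * c * q ^+ (n + 2 * k))^-1 *
  (mulp_factor (a * c * q ^+ n) k * mulp_factor (a * x) k * mulp_factor (a / x) k))).
- do !apply: mulf_neq0; try (apply: mulp_factor_neq0; nonzero).
  by rewrite oppr_eq0; nonzero.
- rewrite /trm_num (@fac_mulp (a * p * c * q ^+ n) (a * c * q ^+ n))
    ?(@fac_mulp (a * p * x) (a * x)) ?(@fac_mulp (a * p / x) (a / x))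
    ?(@th_mulp (a * p * c * q ^+ (n + 2 * k)) (a * c * q ^+ (n + 2 * k)));
    [ring | arg | by nonzero | arg | by nonzero | arg | by nonzero | arg | by nonzero].
- have -> : - (a * c * q ^+ (n + 2 * k))^-1 *
  (mulp_factor (a * c * q ^+ n) k * mulp_factor (a * x) k * mulp_factor (a / x) k) =
    - (a * c * q ^+ n)^-1 * (mulp_factor (a * q / b) k *
       mulp_factor (a * b * q ^+ (1 + n)) k * mulp_factor (a * c) k).
    have e : mulp_factor (a * c * q ^+ n) k * mulp_factor (a * x) k *
        mulp_factor (a / x) k =
      q ^+ (2 * k) * (mulp_factor (a * q / b) k *
       mulp_factor (a * b * q ^+ (1 + n)) k * mulp_factor (a * c) k).
      rewrite expr_double_prod add1n (exprS q n); have qn := qX n.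
      by move: (q ^+ n) qn => Q Q0; factor.
    rewrite e exprD; field.
    by do ?[apply/andP; split]; nonzero.
  rewrite /trm_den (@fac_mulp (a * p * q / b) (a * q / b))
    ?(@fac_mulp (a * p * b * q ^+ (1 + n)) (a * b * q ^+ (1 + n)))
    ?(@fac_mulp (a * p * c) (a * c))
    ?(@th_mulp (a * p * c * q ^+ n) (a * c * q ^+ n));
    [ring | arg | by nonzero | arg | by nonzero | arg | by nonzero | arg | by nonzero].
Qed.

Lemma trm_c n k : trm_num n a b (c * p) x k / trm_den n a b (c * p) x k =
  trm_num n a b c x k / trm_den n a b c x k.
Proof.
apply: (@ratio_scale (- (a * c * q ^+ (n + 2 * k))^-1 *
  (mulp_factor (a * c * q ^+ n) k * mulp_factor (b * c * q ^+ n) k *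
   mulp_factor (c / b) k))).
- do !apply: mulf_neq0; try (apply: mulp_factor_neq0; nonzero).
  by rewrite oppr_eq0; nonzero.
- rewrite /trm_num (@fac_mulp (a * (c * p) * q ^+ n) (a * c * q ^+ n))
    ?(@fac_mulp (b * (c * p) * q ^+ n) (b * c * q ^+ n))
    ?(@fac_mulp (c * p / b) (c / b))
    ?(@th_mulp (a * (c * p) * q ^+ (n + 2 * k)) (a * c * q ^+ (n + 2 * k)));
    [ring | arg | by nonzero | arg | by nonzero | arg | by nonzero | arg | by nonzero].
- have -> : - (a * c * q ^+ (n + 2 * k))^-1 *
  (mulp_factor (a * c * q ^+ n) k * mulp_factor (b * c * q ^+ n) k *
   mulp_factor (c / b) k) =
    - (a * c * q ^+ n)^-1 * (mulp_factor (a * c) k *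
       mulp_factor (c * q ^+ n.+1 / x) k * mulp_factor (c * x * q ^+ n.+1) k).
    have e : mulp_factor (a * c * q ^+ n) k * mulp_factor (b * c * q ^+ n) k *
        mulp_factor (c / b) k =
      q ^+ (2 * k) * (mulp_factor (a * c) k *
       mulp_factor (c * q ^+ n.+1 / x) k * mulp_factor (c * x * q ^+ n.+1) k).
      rewrite expr_double_prod (exprS q n); have qn := qX n.
      by move: (q ^+ n) qn => Q Q0; factor.
    rewrite e exprD; field.
    by do ?[apply/andP; split]; nonzero.
  rewrite /trm_den (@fac_mulp (a * (c * p)) (a * c))
    ?(@fac_mulp (c * p * q ^+ n.+1 / x) (c * q ^+ n.+1 / x))
    ?(@fac_mulp (c * p * x * q ^+ n.+1) (c * x * q ^+ n.+1))
    ?(@th_mulp (a * (c * p) * q ^+ n) (a * c * q ^+ n));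
    [ring | arg | by nonzero | arg | by nonzero | arg | by nonzero | arg | by nonzero].
Qed.

Lemma ratio_sum_mulp n m :
  [/\ ratio_sum n m (a * p) b c x = ratio_sum n m a b c x,
      ratio_sum n m a (b * p) c x = ratio_sum n m a b c x,
      ratio_sum n m a b (c * p) x = ratio_sum n m a b c x &
      ratio_sum n m a b c (x * p) = ratio_sum n m a b c x].
Proof.
split; rewrite /ratio_sum.
- by rewrite pre_a; congr (_ * _); apply: eq_bigr => k _; rewrite trm_a.
- by rewrite pre_b; congr (_ * _); apply: eq_bigr => k _; rewrite trm_b.
- by rewrite pre_c; congr (_ * _); apply: eq_bigr => k _; rewrite trm_c.
- by rewrite pre_x; congr (_ * _); apply: eq_bigr => k _; rewrite trm_x.
Qed.

End QuasiPeriodicity.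

(** * Ellipticity of the summands *)

Section ExponentialFunctions.
Variable R : realType.
Local Notation C := R[i].
Implicit Types (f g : C -> C) (z : C^o).

(** As a function of a single u_i, every theta argument in the summands has this form; al = 0 covers
    the arguments independent of u_i. One lemma per operation then treats all four variables. *)
Definition exponential g := exists (c al : C),
  c != 0 /\ forall w, g w = c * cexp (al * w).

Lemma exponential_cst (c : C) : c != 0 -> exponential (fun=> c).
Proof. by move=> c0; exists c, 0; split => // w; rewrite mul0r cexp0 mulr1. Qed.

Lemma exponentialM f g : exponential f -> exponential g ->
  exponential (fun w => f w * g w).
Proof.
move=> [c [al [c0 hf]]] [d [be [d0 hg]]]; exists (c * d), (al + be).
split; first exact: mulf_neq0.
by move=> w; rewrite hf hg mulrDl cexpD mulrACA.
Qed.

Lemma exponentialV g : exponential g -> exponential (fun w => (g w)^-1).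
Proof.
move=> [c [al [c0 hg]]]; exists c^-1, (- al); split; first exact: invr_neq0.
by move=> w; rewrite hg mulNr cexpN invfM.
Qed.

Lemma exponentialX g n : exponential g -> exponential (fun w => g w ^+ n).
Proof.
move=> hg; elim: n => [|n IH]; first exact: exponential_cst (oner_neq0 _).
by under eq_fun do rewrite exprS; exact: exponentialM.
Qed.

Lemma exponentialXz g (j : int) : exponential g -> exponential (fun w => g w ^ j).
Proof.
case: j => n hg; first exact: exponentialX.
exact: exponentialV (exponentialX n.+1 hg).
Qed.

Lemma exponential_neq0 g w : exponential g -> g w != 0.
Proof. by move=> [c [al [c0 ->]]]; apply: mulf_neq0 => //; exact: cexp_neq0. Qed.

Lemma exponential_derivable g z : exponential g -> derivable (g : C^o -> C^o) z 1.
Proof.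
move=> [c [al [c0 hg]]].
have -> : g = cst c * (fun w : C^o => cexp (al * w + 0) : C^o).
  by apply/funext => w; rewrite hg -[al * w in LHS]addr0.
have d := @derivable_cexp_affine R al 0 z.
have d' : derivable (cst c : C^o -> C^o) z 1 by exact: derivable_cst.
exact: (derivableM d' d).
Qed.

Lemma derivable_compose (f g : C^o -> C^o) z :
  derivable g z 1 -> derivable f (g z) 1 -> derivable (fun w => f (g w)) z 1.
Proof.
move=> dg df; apply: (derivable1_diffP (f \o g) z).2.
exact: differentiable_comp ((derivable1_diffP g z).1 dg) ((derivable1_diffP f (g z)).1 df).
Qed.

Variable p : C.
Hypothesis p_neq0 : p != 0.
Hypothesis p_lt1 : normc p < 1.

Lemma derivable_qpoch_inf z : derivable (fun y : C^o => qpoch_inf y p : C^o) z 1.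
Proof.
have [d [K h]] := qpoch_inf_taylor p_lt1 z.
exact: (@taylor_derivable _ (fun y : C^o => qpoch_inf y p : C^o) z d K 1 ltr01 h).
Qed.

Lemma derivable_qpoch_exponential g z : exponential g ->
  derivable (fun w : C^o => qpoch_inf (g w) p : C^o) z 1.
Proof.
move=> hg.
exact: (@derivable_compose (fun y => qpoch_inf y p) g z
  (@exponential_derivable g z hg) (@derivable_qpoch_inf (g z))).
Qed.

Lemma derivable_theta_exponential g z : exponential g ->
  derivable (fun w : C^o => theta (g w) p : C^o) z 1.
Proof.
move=> hg.
have d1 := @derivable_qpoch_exponential _ z hg.
have hg' := exponentialM (exponential_cst p_neq0) (exponentialV hg).
have d2 := @derivable_qpoch_exponential _ z hg'.
exact: (derivableM d1 d2).
Qed.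

Lemma meromorphic_exponential g z : exponential g -> meromorphic_at g z.
Proof.
move=> hg; apply: (@meromorphic_holomorphic R g z).
by apply: holomorphic_near_all => w; exact: exponential_derivable.
Qed.

Lemma meromorphic_theta g z : exponential g ->
  meromorphic_at (fun w => theta (g w) p) z.
Proof.
move=> hg; apply: (@meromorphic_holomorphic R (fun w => theta (g w) p) z).
by apply: holomorphic_near_all => w; exact: derivable_theta_exponential.
Qed.

(** This moves a zero at p^l to the zero at 1. Only the monomial shape of the multiplier matters
    later, so c and j are left existential. *)
Lemma theta_exprz_shift (l : int) : exists (c : C) (j : int), c != 0 /\
  forall y, y != 0 -> theta (y * p ^ l) p = c * y ^ j * theta y p.
Proof.
case: l => n.
  elim: n => [|n [c [j [c0 h]]]].
    exists 1, 0; split; first exact: oner_neq0.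
    by move=> y _; rewrite !expr0z !mul1r mulr1.
  exists (- (c / p ^+ n)), (j - 1); split.
    by rewrite oppr_eq0; nonzero.
  move=> y y0; have yp : y * p ^ n != 0.
    by apply: mulf_neq0 => //; exact: expf_neq0.
  have -> : y * p ^ n.+1 = y * p ^ n * p by rewrite -mulrA -exprSzr.
  rewrite theta_mulp // h // expfzDr // -[p ^ n]/(p ^+ n).
  rewrite -[y ^ (-1)]/((y ^+ 1)^-1) expr1.
  move: (theta y p) (y ^ j) => t u.
  by field; do ?[apply/andP; split]; nonzero.
elim: n => [|n [c [j [c0 h]]]].
  exists (- p^-1), 1; split; first by rewrite oppr_eq0; nonzero.
  move=> y y0; rewrite -[p ^ Negz 0]/((p ^+ 1)^-1) expr1 theta_divp // expr1z.
  by ring.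
exists (- (c / p / p ^+ n.+1)), (j + 1); split.
  by rewrite oppr_eq0; nonzero.
move=> y y0; have yp : y * p ^ Negz n != 0.
  by apply: mulf_neq0 => //; apply: invr_neq0; exact: expf_neq0.
have -> : y * p ^ Negz n.+1 = y * p ^ Negz n / p.
  rewrite -[p ^ Negz n.+1]/((p ^+ n.+2)^-1) -[p ^ Negz n]/((p ^+ n.+1)^-1) (exprS p n.+1).
  by rewrite invfM mulrA mulrAC.
rewrite theta_divp // h // expfzDr // expr1z -[p ^ Negz n]/((p ^+ n.+1)^-1).
move: (theta y p) (y ^ j) => t u.
by field; do ?[apply/andP; split]; nonzero.
Qed.

(** At a zero g z = p^l, write g = y p^l with y = exp (al (w - z)). In theta(y) = (1 - y) (y p)_inf
    (p / y)_inf both infinite products are nonzero at y = 1, so only 1 / (1 - y) has a pole. *)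
Lemma meromorphic_thetaV g z : exponential g ->
  meromorphic_at (fun w => (theta (g w) p)^-1) z.
Proof.
move=> hg; have [gz0|gz] := eqVneq (theta (g z) p) 0; last first.
  apply: (@meromorphic_holomorphic R (fun w => (theta (g w) p)^-1) z).
  apply: (@holomorphic_nearV R (fun w => theta (g w) p) z _ gz).
  by apply: holomorphic_near_all => w; exact: derivable_theta_exponential.
have [c [al [c0 gE]]] := hg.
(* Here g is constant at a zero of theta, and the inverse is the constant 0. *)
have [al0|al0] := eqVneq al 0.
  have -> : (fun w => (theta (g w) p)^-1) = fun=> 0.
    apply/funext => w; have -> : g w = g z by rewrite !gE al0 !mul0r.
    by rewrite gz0 invr0.
  exact: meromorphic_at_cst.
have [l gl] := theta_eq0 p_neq0 p_lt1 (exponential_neq0 z hg) gz0.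
have [d [j [d0 sh]]] := theta_exprz_shift l.
pose y w : C := cexp (al * (w - z)).
have hy : exponential y.
  exists (cexp (- (al * z))), al; split; first exact: cexp_neq0.
  by move=> w; rewrite /y mulrBr addrC cexpD.
have yz : y z = 1 by rewrite /y subrr mulr0 cexp0.
have gy w : g w = y w * p ^ l.
  rewrite -gl !gE mulrCA /y -cexpD; congr (_ * cexp _); ring.
have hyp := exponentialM hy (exponential_cst p_neq0).
have hpy := exponentialM (exponential_cst p_neq0) (exponentialV hy).
have qV f : exponential f -> f z = p ->
    meromorphic_at (fun w => (qpoch_inf (f w) p)^-1) z.
  move=> hf fz.
  apply: (@meromorphic_holomorphic R (fun w => (qpoch_inf (f w) p)^-1) z).
  apply: (@holomorphic_nearV R (fun w => qpoch_inf (f w) p) z).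
    by apply: holomorphic_near_all => w; exact: derivable_qpoch_exponential.
  by rewrite fz; exact: qpochpp_neq0.
have -> : (fun w => (theta (g w) p)^-1) = (fun w => d^-1 * (y w ^ j)^-1 *
   ((1 - y w)^-1 * ((qpoch_inf (y w * p) p)^-1 * (qpoch_inf (p / y w) p)^-1))).
  apply/funext => w; rewrite gy sh; last exact: exponential_neq0.
  by rewrite (thetaE p_lt1) !invfM -!mulrA.
apply: meromorphic_atM.
  apply: meromorphic_exponential; apply: exponentialM.
    by apply: exponential_cst; exact: invr_neq0.
  exact: exponentialV (exponentialXz j hy).
apply: meromorphic_atM; first exact: meromorphic_atV_cexp.
apply: meromorphic_atM; first by apply: qV hyp _; rewrite yz mul1r.
by apply: qV hpy _; rewrite yz divr1.
Qed.

(** * Meromorphy and periodicity of the summands *)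

Variable q : C.
Hypothesis q_neq0 : q != 0.

(** A nested conjunction, so that a proof is a tuple with one fact for each argument. *)
Definition all_exponential (gs : seq (C -> C)) : Prop :=
  foldr (fun g P => exponential g /\ P) True gs.

Lemma meromorphic_theta_fact gs k z : all_exponential gs ->
  meromorphic_at (fun w => theta_fact [seq g w | g <- gs] q p k) z.
Proof.
elim: gs => [_|g gs IH [hg hgs]]; rewrite /theta_fact.
  by under eq_fun do rewrite big_nil; exact: meromorphic_at_cst.
under eq_fun do rewrite big_cons; apply: meromorphic_atM; last exact: IH.
apply: meromorphic_at_prod => l; apply: meromorphic_theta.
by apply: exponentialM hg _; apply: exponential_cst; exact: expf_neq0.
Qed.

Lemma meromorphic_theta_factV gs k z : all_exponential gs ->
  meromorphic_at (fun w => (theta_fact [seq g w | g <- gs] q p k)^-1) z.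
Proof.
elim: gs => [_|g gs IH [hg hgs]]; rewrite /theta_fact.
  by under eq_fun do rewrite big_nil; exact: meromorphic_at_cst.
under eq_fun do rewrite big_cons invfM; apply: meromorphic_atM; last exact: IH.
under eq_fun do rewrite /theta_fact1 -prodfV.
apply: meromorphic_at_prod => l; apply: meromorphic_thetaV.
by apply: exponentialM hg _; apply: exponential_cst; exact: expf_neq0.
Qed.

Lemma meromorphic_summand n m a b c x z :
  exponential a -> exponential b -> exponential c -> exponential x ->
  meromorphic_at (fun w => summand q p n m (a w) (b w) (c w) (x w)) z.
Proof.
move=> ha hb hc hx.
have hq j : exponential (fun=> q ^+ j).
  by apply: exponential_cst; exact: expf_neq0.
have hq1 : exponential (fun=> q) := exponential_cst q_neq0.
have hM := exponentialM; have hV := exponentialV.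
have ac := hM _ _ ha hc; have bc := hM _ _ hb hc; have ab := hM _ _ ha hb.
have ax := hM _ _ ha hx; have bx := hM _ _ hb hx; have cx := hM _ _ hc hx.
have cVa := hM _ _ hc (hV _ ha); have bVx := hM _ _ hb (hV _ hx).
have bVa := hM _ _ hb (hV _ ha); have cVx := hM _ _ hc (hV _ hx).
have cVb := hM _ _ hc (hV _ hb); have aVx := hM _ _ ha (hV _ hx).
have aqVb := hM _ _ (hM _ _ ha hq1) (hV _ hb).
have cqVx := hM _ _ (hM _ _ hc (hq n.+1)) (hV _ hx).
have h1 : meromorphic_at (fun w => prefactor_num q p n (a w) (b w) (c w) (x w)) z.
  exact: (@meromorphic_theta_fact [:: fun w => a w * c w; fun w => c w / a w;
    fun w => b w * x w; fun w => b w / x w] n.+1 z (conj ac (conj cVa (conj bx (conj bVx I))))).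
have h2 : meromorphic_at (fun w => (prefactor_den q p n (a w) (b w) (c w) (x w))^-1) z.
  exact: (@meromorphic_theta_factV [:: fun w => a w * b w; fun w => b w / a w;
    fun w => c w * x w; fun w => c w / x w] n.+1 z (conj ab (conj bVa (conj cx (conj cVx I))))).
have h3 k : meromorphic_at (fun w => term_num q p n (a w) (b w) (c w) (x w) k) z.
  apply: meromorphic_atM; first exact: (meromorphic_theta z (hM _ _ ac (hq (n + 2 * k)%N))).
  exact: (@meromorphic_theta_fact [:: fun w => a w * c w * q ^+ n;
    fun w => b w * c w * q ^+ n; fun w => c w / b w; fun w => q ^+ n.+1;
    fun w => a w * x w; fun w => a w / x w] k z
   (conj (hM _ _ ac (hq n)) (conj (hM _ _ bc (hq n)) (conj cVb (conj (hq n.+1)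
   (conj ax (conj aVx I))))))).
have h4 k : meromorphic_at (fun w => (term_den q p n (a w) (b w) (c w) (x w) k)^-1) z.
  under eq_fun do rewrite invfM.
  apply: meromorphic_atM; first exact: (meromorphic_thetaV z (hM _ _ ac (hq n))).
  exact: (@meromorphic_theta_factV [:: fun w => q; fun w => a w * q / b w;
    fun w => a w * b w * q ^+ (1 + n); fun w => a w * c w;
    fun w => c w * q ^+ n.+1 / x w; fun w => c w * x w * q ^+ n.+1] k z
   (conj hq1 (conj aqVb (conj (hM _ _ ab (hq (1 + n)%N)) (conj ac
   (conj cqVx (conj (hM _ _ cx (hq n.+1)) I))))))).
apply: meromorphic_atM; first exact: meromorphic_atM h1 h2.
apply: meromorphic_at_sum => k; apply: meromorphic_atM (meromorphic_atM (h3 k) (h4 k)) _.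
exact: meromorphic_at_cst.
Qed.

Local Notation th := (fun y : C => theta y p).

Lemma summandE_ratio_sum n m a b c x :
  summand q p n m a b c x = ratio_sum th q n m a b c x.
Proof.
have e1 : prefactor_num q p n a b c x = pre_num th q n.+1 a b c x.
  by rewrite /prefactor_num /theta_fact !big_cons big_nil mulr1 !theta_fact1E.
have e2 : prefactor_den q p n a b c x = pre_den th q n.+1 a b c x.
  by rewrite /prefactor_den /theta_fact !big_cons big_nil mulr1 !theta_fact1E.
rewrite /summand /ratio_sum e1 e2; congr (_ * _); apply: eq_bigr => k _; congr (_ / _ * _).
  by rewrite /term_num /theta_fact !big_cons big_nil mulr1 !theta_fact1E.
by rewrite /term_den /theta_fact !big_cons big_nil mulr1 !theta_fact1E.
Qed.

Lemma summand_mulp n m a b c x : a != 0 -> b != 0 -> c != 0 -> x != 0 ->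
  [/\ summand q p n m (a * p) b c x = summand q p n m a b c x,
      summand q p n m a (b * p) c x = summand q p n m a b c x,
      summand q p n m a b (c * p) x = summand q p n m a b c x &
      summand q p n m a b c (x * p) = summand q p n m a b c x].
Proof.
move=> a0 b0 c0 x0; rewrite !summandE_ratio_sum.
exact: (@ratio_sum_mulp _ th p q p_neq0 q_neq0 (theta_mulp p_neq0 p_lt1)
  (theta_divp p_neq0 p_lt1) a b c x a0 b0 c0 x0 n m).
Qed.

End ExponentialFunctions.

Theorem theorem1p1 (R : realType) (q p : R[i]) (n m : nat)
    (q_neq0 : q != 0) (p_gt0 : 0 < `|p|) (p_lt1 : `|p| < 1) :
  (forall a b c x : R[i], a != 0 -> b != 0 -> c != 0 -> x != 0 ->
     regular_point q p n m a b c x -> regular_point q p m n b a c x ->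
     1 = summand q p n m a b c x + summand q p m n b a c x)
  /\
  (forall sigma tau : R[i], sigma != 0 -> 0 < complex.Im tau ->
     q = cexp2pi sigma -> p = cexp2pi tau ->
     let pow_q (w : R[i]) := cexp2pi (sigma * w) in
     totally_elliptic sigma tau
       (fun u : 'I_4 -> R[i] =>
          let x := pow_q (u 0) in let a := pow_q (u 1) in
          let b := pow_q (u 2) in let c := pow_q (u 3) in
          summand q p n m a b c x)
     /\
     totally_elliptic sigma tau
       (fun u : 'I_4 -> R[i] =>
          let x := pow_q (u 0) in let a := pow_q (u 1) in
          let b := pow_q (u 2) in let c := pow_q (u 3) in
          summand q p m n b a c x)).
Proof.
have p_neq0 : p != 0 by rewrite -normr_gt0.
have p_lt1' : normc p < 1 by move: p_lt1; rewrite normr_normc ltcR.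
split; first by move=> a b c x; exact: identity_at_regular_point.
move=> sigma tau sigma0 _ qE pE pow_q.
have pow_q0 w : pow_q w != 0 by exact: cexp_neq0.
have pow_q_period w : pow_q (w + sigma^-1) = pow_q w.
  rewrite /pow_q mulrDr divff // /cexp2pi mulrDr cexpD.
  by rewrite -/(cexp2pi 1) cexp_2pi mulr1.
have pow_q_quasi w : pow_q (w + tau / sigma) = pow_q w * p.
  rewrite /pow_q mulrDr mulrCA divff // mulr1 /cexp2pi mulrDr cexpD.
  by rewrite pE.
have pow_q_exp i (u : 'I_4 -> R[i]) j :
    exponential (fun w => pow_q ([eta u with i |-> w] j)).
  rewrite /=; case: (j == i); last exact: exponential_cst.
  exists 1, ((0 +i* (2 * pi)) * sigma); split; first exact: oner_neq0.
  by move=> w; rewrite mul1r -mulrA.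
(* Both summands are instances of S, with arguments in the order x, a, b, c of the coordinates; they
   differ by exchanging a with b and n with m. *)
have elliptic (S : R[i] -> R[i] -> R[i] -> R[i] -> R[i]) :
    (forall a b c x : R[i] -> R[i], exponential a -> exponential b ->
       exponential c -> exponential x ->
       forall z, meromorphic_at (fun w => S (x w) (a w) (b w) (c w)) z) ->
    (forall a b c x, a != 0 -> b != 0 -> c != 0 -> x != 0 ->
      [/\ S (x * p) a b c = S x a b c, S x (a * p) b c = S x a b c,
          S x a (b * p) c = S x a b c & S x a b (c * p) = S x a b c]) ->
    totally_elliptic sigma tau
      (fun u : 'I_4 -> R[i] => S (pow_q (u 0)) (pow_q (u 1)) (pow_q (u 2)) (pow_q (u 3))).
  move=> hmero hper i u; split.
  - by move=> z; exact: (hmero _ _ _ _ (pow_q_exp i u 1) (pow_q_exp i u 2)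
      (pow_q_exp i u 3) (pow_q_exp i u 0) z).
  - move=> w /=.
    have e j : pow_q (if j == i then w + sigma^-1 else u j) =
       pow_q (if j == i then w else u j).
      by case: (j == i); rewrite ?pow_q_period.
    by rewrite !e.
  - move=> w /=.
    (* Adding tau / sigma to u_i multiplies exactly one of the four arguments by p. Writing the
       multiplier uniformly in j postpones the case analysis on i to the end. *)
    have e j : pow_q (if j == i then w + tau / sigma else u j) =
       pow_q (if j == i then w else u j) * (if j == i then p else 1).
      by case: (j == i); rewrite ?pow_q_quasi ?mulr1.
    rewrite !e.
    set x := pow_q (if 0 == i then _ else _).
    set a := pow_q (if 1 == i then _ else _).
    set b := pow_q (if 2 == i then _ else _).
    set c := pow_q (if 3 == i then _ else _).
    have [h0 h1 h2 h3] := hper a b c x (pow_q0 _) (pow_q0 _) (pow_q0 _) (pow_q0 _).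
    clearbody x a b c; clear e.
    by case: i => -[|[|[|[|//]]]] ilt; rewrite /eq_op /= !mulr1.
split.
- apply: (elliptic (fun x a b c => summand q p n m a b c x)).
    by move=> a b c x ha hb hc hx z; exact: meromorphic_summand.
  move=> a b c x a0 b0 c0 x0.
  by have [] := summand_mulp p_neq0 p_lt1' q_neq0 n m a0 b0 c0 x0.
- apply: (elliptic (fun x a b c => summand q p m n b a c x)).
    by move=> a b c x ha hb hc hx z; exact: meromorphic_summand.
  move=> a b c x a0 b0 c0 x0.
  by have [] := summand_mulp p_neq0 p_lt1' q_neq0 m n b0 a0 c0 x0.
Qed.
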